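(* Consider the fluid queueing network described in the context, with routing matrix $R=(r(i,j))$, with external arrival rates $e(i)(\cdot)$ and service rates $c(i)(\cdot)$ all periodic with the same period $T>0$. Suppose the stability condition holds: there exists $\epsilon>0$ such that, componentwise, $$\bar c > [I-R^\top]^{-1}\bar e+\epsilon \mathbf 1 .$$ Then there exists a unique periodic state trajectory $(x^*,\beta^* )$ with period $T$, and every state trajectory $(x,\beta)$ (i.e. the trajectory from any admissible initial condition) converges to $(x^*,\beta^* )$; that is, with $b$ and $b^*$ the corresponding departure rates, $$\lim_{t\to\infty}|x(t)-x^*(t)|=0\quad\text{and}\quad \lim_{t\to\infty}\ \sup_{s\in[t-\bar\tau,t]}\Big|\int_{t-\bar\tau}^{s}[b(r)-b^*(r)]\,dr\Big|=0 .$$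
   Context: Network: there are finitely many queues $i=1,\dots,n$. The routing ratios satisfy $r(i,j)\ge 0$, $\sum_j r(i,j)\le 1$, and every vehicle eventually leaves, i.e. $[I-R^\top]^{-1}=I+R^\top+(R^\top)^2+\cdots$ exists, where $R=(r(i,j))$ and $R^\top$ is its transpose. Travel times are $\tau(i,j)>0$; $\bar\tau=\max\tau(i,j)$. The external arrival rates $e(i)(t)\ge0$ and service (saturation) rates $c(i)(t)\ge 0$, $t\ge0$, are measurable and locally integrable. Queues have infinite storage capacity. An admissible initial condition consists of $x(i)(0)\ge0$ and an integrable departure history $b(i)(s)\ge0$, $s\in[-\bar\tau,0]$, for every $i$. The corresponding trajectory is the unique (departure rates being identified when equal almost everywhere) family of absolutely continuous queue lengths $x(i)(t)\ge0$, $t\ge0$, and departure rates $b(i)(t)$ such that, for almost every $t\ge 0$ and all $i$, $$\dot x(i)(t)=e(i)(t)+\sum_j b(j)(t-\tau(j,i))\,r(j,i)-b(i)(t),$$ $$b(i)(t)=c(i)(t)\ \text{if } x(i)(t)>0,\qquad b(i)(t)\in[0,c(i)(t)]\ \text{if } x(i)(t)=0 .$$ The state at time $t\ge0$ is $(x(t),\beta(t))$, where $\beta(t)$ is the departure history $s\in[t-\bar\tau,t]\mapsto b(s)$. A state trajectory is periodic with period $T$ if $x(t+T)=x(t)$ for all $t\ge0$ and $b(s+T)=b(s)$ for almost every $s\ge-\bar\tau$. Averages: $\bar e(i)=\frac1T\int_0^T e(i)(t)\,dt$, $\bar c(i)=\frac1T\int_0^T c(i)(t)\,dt$; $\bar e,\bar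 c$ are the vectors of these; $\mathbf 1$ is the all-ones vector. *)

(* Defs.v *)
(* Measurability is Borel measurability; norms of column vectors are sup norms. *)
From mathcomp Require Import all_boot all_order all_algebra.
From mathcomp Require Import all_classical all_reals all_analysis.
Set Implicit Arguments.
Unset Strict Implicit.
Unset Printing Implicit Defensive.
Import Order.TTheory GRing.Theory Num.Theory.
Import numFieldNormedType.Exports.

Local Open Scope classical_set_scope.
Local Open Scope ring_scope.

Section FluidNetwork.
Context {R : realType} {n : nat}.
Local Notation mu := (@lebesgue_measure R).

(* M = 1 + A + A^2 + ... converges and is the inverse of 1 - A; the membership
   in unitmx is needed because invmx is the identity on singular matrices. *)
Definition neumann_invertible (A : 'M[R]_n) : Prop :=
  1%:M - A \in unitmx /\
  (fun N : nat => \sum_(k < N) A ^+ k) @ \oo --> invmx (1%:M - A).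

(* Only the values on [0, +oo[ matter. *)
Definition rate_function (f : R -> R) : Prop :=
  (forall t, 0 <= t -> 0 <= f t) /\
  (forall M, 0 <= M -> mu.-integrable `[0, M] (EFin \o f)).

Definition periodic_from (a T : R) (f : R -> R) : Prop :=
  forall t, a <= t -> f (t + T) = f t.

Definition average (T : R) (f : 'I_n -> R -> R) : 'cV[R]_n :=
  \col_i (T^-1 * \int[mu]_(t in `[0, T]) f i t).

Definition absolutely_continuous (a b : R) (f : R -> R) : Prop :=
  forall eps : R, 0 < eps -> exists2 delta : R, 0 < delta &
    forall (m : nat) (u v : 'I_m -> R),
      (forall k, a <= u k <= v k /\ v k <= b) ->
      trivIset setT (fun k => `]u k, v k[%classic) ->
      \sum_(k < m) (v k - u k) < delta ->
      \sum_(k < m) `|f (v k) - f (u k)| < eps.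

(* Travel times are positive, so the default value 0 is harmless for n > 0. *)
Definition max_travel_time (tau : 'I_n -> 'I_n -> R) : R :=
  \big[Num.max/0]_(i < n) \big[Num.max/0]_(j < n) tau i j.

Definition admissible_initial (tau : 'I_n -> 'I_n -> R)
    (x0 : 'I_n -> R) (b0 : 'I_n -> R -> R) : Prop :=
  let tbar := max_travel_time tau in
  forall i, [/\ 0 <= x0 i,
    forall s, - tbar <= s <= 0 -> 0 <= b0 i s &
    mu.-integrable `[- tbar, 0] (EFin \o b0 i)].

(* x is only meaningful on [0, +oo[ and b on [- tbar, +oo[, where b on
   [- tbar, 0] is the initial departure history. *)
Definition trajectory (r : 'M[R]_n) (tau : 'I_n -> 'I_n -> R)
    (e c : 'I_n -> R -> R) (x b : 'I_n -> R -> R) : Prop :=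
  [/\ admissible_initial tau (x ^~ 0) b,
      forall i, measurable_fun (`[0, +oo[ : set R) (b i),
      forall i t, 0 <= t -> 0 <= x i t,
      forall i M, 0 <= M -> absolutely_continuous 0 M (x i) &
      {ae mu, forall t : R, 0 <= t -> forall i,
        [/\ is_derive t 1 (x i)
              (e i t + \sum_(j < n) b j (t - tau j i) * r j i - b i t),
            0 < x i t -> b i t = c i t &
            x i t = 0 -> 0 <= b i t <= c i t]}].

Definition periodic_trajectory (tau : 'I_n -> 'I_n -> R) (T : R)
    (x b : 'I_n -> R -> R) : Prop :=
  (forall i, periodic_from 0 T (x i)) /\
  {ae mu, forall s : R, - max_travel_time tau <= s ->
     forall i, b i (s + T) = b i s}.

(* Departure rates that agree almost everywhere are identified. *)
Definition same_trajectory (tau : 'I_n -> 'I_n -> R)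
    (x b x' b' : 'I_n -> R -> R) : Prop :=
  (forall i t, 0 <= t -> x i t = x' i t) /\
  {ae mu, forall s : R, - max_travel_time tau <= s -> forall i, b i s = b' i s}.

(* The supremum is taken in \bar R, so it is never a default value. *)
Definition history_distance (tau : 'I_n -> 'I_n -> R)
    (b b' : 'I_n -> R -> R) (t : R) : \bar R :=
  let tbar := max_travel_time tau in
  ereal_sup [set (`| \col_i \int[mu]_(u in `[t - tbar, s])
                       (b i u - b' i u) : 'cV[R]_n |)%:E
            | s in `[t - tbar, t]].

Definition converges_to (tau : 'I_n -> 'I_n -> R)
    (x b x' b' : 'I_n -> R -> R) : Prop :=
  `| \col_i (x i t - x' i t) : 'cV[R]_n | @[t --> +oo] --> (0 : R) /\
  history_distance tau b b' t @[t --> +oo] --> 0%E.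

End FluidNetwork.

(* Main.v *)
(* Compare two trajectories with the same demand and service.  For one queue,
   |x - x'| grows at rate at most |a - a'| - |b - b'|, where a, a' are the
   arrival rates: if x > x' then b = c >= b', and where x = x' = 0 both
   derivatives vanish because x and x' are nonnegative.  Weighting queue i by
   w_i, with w the column sums of [I - R^T]^{-1} (so that R w = w - 1), and
   adding up, routed and departing differences cancel and the integral of
   sum_j |b_j - b'_j| over [0, +oo[ is finite.  Departure rates of any two
   trajectories thus merge in L^1.

   Stability forces every queue of every trajectory to empty in every
   sufficiently late period, since otherwise it would send out nearly its full
   average service rate forever.  From a common period of emptying on, |x - x'|
   is bounded by the recent L^1 difference of the arrivals; hence x - x' -> 0.

   Applied to a trajectory and its shift by T, the same two facts show that
   x(t + kT) and b(t + kT) converge as k -> oo; the limit is the periodic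
   trajectory. *)
Require Import Defs.
From mathcomp Require Import all_boot all_order all_algebra.
From mathcomp Require Import all_classical all_reals all_analysis measurable_realfun.
From mathcomp Require Import ring lra.
Set Implicit Arguments.
Unset Strict Implicit.
Unset Printing Implicit Defensive.
Import Order.TTheory GRing.Theory Num.Theory.
Import numFieldNormedType.Exports.
Local Open Scope classical_set_scope.
Local Open Scope ring_scope.

(** The comparison needs a fundamental theorem of calculus for absolutely continuous functions that
    assumes slope bounds instead of derivatives, since |x - x'| may have a kink where x = x'. Slopes
    over intervals straddling a point are integrated by a covering argument. Some trajectory must
    exist before its shifts can have a limit. Travel times are bounded below by some d > 0, so over
    a stretch of length d the internal arrivals are already known, and the network splits into
    single queues, each solved from the empty state by reflection. The obstacle is the set of times
    at which a queue is empty: the reflection formula gives no derivative there. Composing with a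
    smooth function that vanishes to second order at 0, and letting it tend to the identity, avoids
    the question. The limit of b(t + kT) is taken almost everywhere and not only in L^1, so that the
    rule b = c at busy times survives it. By Tonelli, the finite L^1 distance between a trajectory
    and its shift makes the increments |b(t + (k+1)T) - b(t + kT)| summable over k for almost every
    t. *)

(** * Integrals of locally integrable functions over intervals *)

Section LocalIntegrals.
Context {R : realType}.
Local Notation mu := (@lebesgue_measure R).
Implicit Types (f g : R -> R) (u v w t s : R).

Lemma ae_imp (P Q : R -> Prop) :
  (forall t, P t -> Q t) -> {ae mu, forall t, P t} -> {ae mu, forall t, Q t}.
Proof.
have F := ae_filter_ringOfSetsType mu.
by move=> PQ; exact: (@filterS _ _ F _ _ PQ).
Qed.

Lemma ae_and (P Q : R -> Prop) :
  {ae mu, forall t, P t} -> {ae mu, forall t, Q t} ->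
  {ae mu, forall t, P t /\ Q t}.
Proof.
have F := ae_filter_ringOfSetsType mu.
exact: (@filterI _ _ F).
Qed.

Lemma ae_forall_ord (m : nat) (P : 'I_m -> R -> Prop) :
  (forall i, {ae mu, forall t, P i t}) -> {ae mu, forall t, forall i, P i t}.
Proof.
move=> H.
have : {ae mu, forall t, forall k : nat, forall h : (k < m)%N, P (Ordinal h) t}.
  apply: ae_foralln => k.
  have [h|h] := pselect (is_true (k < m)%N).
    by apply: ae_imp (H (Ordinal h)) => t Pt h'; rewrite (bool_irrelevance h' h).
  by apply: aeW => t h'; case: (h h').
by apply: ae_imp => t Pt [k h]; apply: Pt.
Qed.

Lemma ae_neq a : {ae mu, forall t, t <> a}.
Proof.
exists [set a]; split; [exact: measurable_set1|exact: lebesgue_measure_set1|].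
by move=> t /= /contrapT.
Qed.

Local Notation shiftR s :=
  ((fun t : R => t - s) : measurableTypeR R -> measurableTypeR R).

Lemma measurable_shift s : measurable_fun setT (shiftR s).
Proof. exact: measurable_funB. Qed.

Lemma lebesgue_measure_shift s (A : set (measurableTypeR R)) : measurable A ->
  pushforward mu (shiftR s) A = mu A.
Proof.
move=> mA; apply/esym/lebesgue_measure_unique => //=.
  exact: measurable_shift.
move=> _ _ [[a b]] _ <-; rewrite /pushforward /=.
have -> : (fun t : R => t - s) @^-1` `]a, b] = `](a + s), (b + s)]%classic.
  by apply/seteqP; split => x /=; rewrite !in_itv /= ltrBrDr lerBlDr.
by rewrite !lebesgue_measure_itv /= !lte_fin ltrD2r -!EFinD opprD addrACA subrr addr0.
Qed.

Lemma ae_shift (P : R -> Prop) s :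
  {ae mu, forall t, P t} -> {ae mu, forall t, P (t - s)}.
Proof.
move=> [N [mN N0 PN]].
have ms := measurable_shift s.
exists ((fun t => t - s) @^-1` N); split.
- by rewrite -[X in measurable X]setTI; exact: ms.
- by have := lebesgue_measure_shift s mN; rewrite /pushforward N0.
- by move=> t /= nP; apply: PN.
Qed.

(** Imposed on the whole line, so that shifts by travel times and periods carry no side conditions;
    functions given on a half-line enter through [from], their extension by 0. *)
Definition loc_int f := forall u v, mu.-integrable `[u, v] (EFin \o f).

Lemma loc_int_meas_itv f u v : loc_int f -> measurable_fun `[u, v] f.
Proof. by move=> /(_ u v)/measurable_int/measurable_EFinP. Qed.

Lemma loc_int_emeas f u v : loc_int f ->
  measurable_fun (`[u, v] : set (measurableTypeR R)) (EFin \o f).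
Proof. by move=> /(_ u v)/measurable_int. Qed.

Lemma loc_int_meas f : loc_int f -> measurable_fun setT f.
Proof.
move=> lf; rewrite -(bigcup_itvT true false).
apply/measurable_fun_bigcup => // k.
exact: loc_int_meas_itv.
Qed.

Lemma loc_int_dom f g : measurable_fun setT f -> loc_int g ->
  {ae mu, forall t, `|f t| <= `|g t|} -> loc_int f.
Proof.
move=> mf lg fg u v; apply/integrableP; split.
  by apply/measurable_EFinP; apply: measurable_funS mf.
have /integrableP[_] := lg u v; apply: le_lt_trans.
apply: ae_ge0_le_integral => //=.
- by apply/measurable_EFinP/measurableT_comp => //; apply: measurable_funS mf.
- by apply/measurable_EFinP/measurableT_comp => //; exact: loc_int_meas_itv.
- by apply: ae_imp fg => t h _; rewrite lee_fin.
Qed.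

Lemma loc_int0 : loc_int (cst 0).
Proof. by move=> u v; exact: integrable0. Qed.

Lemma loc_intD f g : loc_int f -> loc_int g -> loc_int (fun t => f t + g t).
Proof. by move=> lf lg u v; have := integrableD _ (lf u v) (lg u v); apply. Qed.

Lemma loc_intB f g : loc_int f -> loc_int g -> loc_int (fun t => f t - g t).
Proof. by move=> lf lg u v; have := integrableB _ (lf u v) (lg u v); apply. Qed.

Lemma loc_intZ f (k : R) : loc_int f -> loc_int (fun t => f t * k).
Proof.
move=> lf u v; have := integrableZr _ k (lf u v).
by apply.
Qed.

Lemma loc_int_sum (m : nat) (F : 'I_m -> R -> R) :
  (forall i, loc_int (F i)) -> loc_int (fun t => \sum_i F i t).
Proof.
elim: m F => [|m IH] F lF.
  by under eq_fun do rewrite big_ord0; exact: loc_int0.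
under eq_fun do rewrite big_ord_recl.
by apply: loc_intD => //; exact: IH.
Qed.

Lemma loc_int_norm f : loc_int f -> loc_int (fun t => `|f t|).
Proof. by move=> lf u v; exact: integrable_norm. Qed.

Lemma loc_int_shift f s : loc_int f -> loc_int (fun t => f (t - s)).
Proof.
move=> lf u v.
have ms := measurable_shift s.
have mf := loc_int_meas lf.
apply/integrableP; split.
  apply/measurable_EFinP; apply: measurable_funS (measurableT_comp mf ms) => //.
have /integrableP[_] := lf (u - s) (v - s).
set u' := u - s; set v' := v - s.
have E : `[u, v]%classic = (fun t => t - s) @^-1` `[u', v'].
  by apply/seteqP; split => x /=; rewrite !in_itv /= !lerD2r.
rewrite E -(@ge0_integral_pushforward _ _ _ _ _ _ ms mu `[u', v'] (fun x => `|f x|%:E)) //=.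
- congr (_ < _)%E.
  by apply: eq_measure_integral => A mA _; exact/esym/lebesgue_measure_shift.
- apply/measurable_EFinP/measurableT_comp => //.
  exact: measurable_funS mf.
Qed.

(* [I f u v] is 0, not [- I f v u], when [v < u]. *)
Definition I f u v : R := \int[mu]_(x in `[u, v]) f x.

Lemma eq_I f g u v : (forall t, u <= t -> t <= v -> f t = g t) -> I f u v = I g u v.
Proof.
move=> fg; apply: eq_Rintegral => t; rewrite inE /= in_itv /= => /andP[].
exact: fg.
Qed.

Lemma I_pt f u : I f u u = 0.
Proof. by rewrite /I set_itv1 Rintegral_set1. Qed.

Lemma I_split f u v w : loc_int f -> u <= v -> v <= w ->
  I f u w = I f u v + I f v w.
Proof.
move=> lf uv vw.
have := @Rintegral_itvB R f (BLeft u) (BRight w) v (lf u w).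
rewrite !bnd_simp => /(_ uv vw) /eqP; rewrite subr_eq => /eqP.
rewrite /I => ->; rewrite addrC Rintegral_itv_obnd_cbnd //.
by apply: integrableS (lf v w) => //; apply: subset_itv; rewrite bnd_simp.
Qed.

Lemma I_D f g u v : loc_int f -> loc_int g ->
  I (fun t => f t + g t) u v = I f u v + I g u v.
Proof. by move=> lf lg; exact: RintegralD. Qed.

Lemma I_B f g u v : loc_int f -> loc_int g ->
  I (fun t => f t - g t) u v = I f u v - I g u v.
Proof. by move=> lf lg; exact: RintegralB. Qed.

Lemma I_Z f k u v : loc_int f -> I (fun t => f t * k) u v = I f u v * k.
Proof. by move=> lf; exact: RintegralZr. Qed.

Lemma I_sum (m : nat) (F : 'I_m -> R -> R) u v : (forall i, loc_int (F i)) ->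
  I (fun t => \sum_i F i t) u v = \sum_i I (F i) u v.
Proof.
elim: m F => [|m IH] F lF.
  rewrite big_ord0 /I; under eq_Rintegral do rewrite big_ord0.
  by rewrite Rintegral_cst // mul0r.
rewrite big_ord_recl -IH // -I_D //; last exact: loc_int_sum.
by apply: eq_I => t _ _; rewrite big_ord_recl.
Qed.

Lemma I_eq_ae f g u v : loc_int f -> loc_int g ->
  {ae mu, forall t, u < t -> t < v -> f t = g t} -> I f u v = I g u v.
Proof.
move=> lf lg fg; rewrite /I /Rintegral; congr fine.
apply: ae_eq_integral => //; try exact: loc_int_emeas.
have H := ae_and (ae_and (ae_neq u) (ae_neq v)) fg.
apply: ae_imp H => t [[tu tv] h] /=.
rewrite in_itv /= => /andP[ut tv']; rewrite h // lt_neqAle ?ut ?tv' andbT.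
  by apply/eqP => /esym.
by apply/eqP.
Qed.

Lemma I_ge0 f u v : loc_int f ->
  {ae mu, forall t, u < t -> t < v -> 0 <= f t} -> 0 <= I f u v.
Proof.
move=> lf f0.
rewrite (@I_eq_ae f (fun t => `|f t|)) //; last 2 first.
- exact: loc_int_norm.
- by apply: ae_imp f0 => t h ut tv; rewrite ger0_norm // h.
by apply: Rintegral_ge0.
Qed.

Lemma I_le f g u v : loc_int f -> loc_int g ->
  {ae mu, forall t, u < t -> t < v -> f t <= g t} -> I f u v <= I g u v.
Proof.
move=> lf lg fg; rewrite -subr_ge0 -I_B //; apply: I_ge0; first exact: loc_intB.
by apply: ae_imp fg => t h ut tv; rewrite subr_ge0 h.
Qed.

Lemma I_norm f u v : loc_int f -> `|I f u v| <= I (fun t => `|f t|) u v.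
Proof. by move=> lf; exact: le_normr_Rintegral. Qed.

Lemma I_norm_ge0 f u v : 0 <= I (fun t => `|f t|) u v.
Proof. by apply: Rintegral_ge0. Qed.

Lemma I_cst k u v : u <= v -> I (fun _ => k) u v = k * (v - u).
Proof.
move=> uv; rewrite /I Rintegral_cst //= lebesgue_measure_itv /= lte_fin.
by case: ltgtP uv => // -> _ /=; rewrite subrr.
Qed.

Lemma loc_int_cst k : loc_int (fun _ => k).
Proof.
move=> u v; apply: measurable_bounded_integrable => //=.
  by rewrite lebesgue_measure_itv /=; case: ifP => //; rewrite ltry.
by exists `|k|; split => // M kM x _; exact: ltW.
Qed.

Lemma I_shift f s u v : loc_int f ->
  I (fun t => f (t - s)) u v = I f (u - s) (v - s).
Proof.
move=> lf.
have ms := measurable_shift s.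
have mf := loc_int_meas lf.
rewrite /I /Rintegral; congr fine.
have := loc_int_shift s lf u v.
set u' := u - s; set v' := v - s.
have -> : `[u, v]%classic = (fun t => t - s) @^-1` `[u', v'].
  by apply/seteqP; split => x /=; rewrite !in_itv /= !lerD2r.
move=> if'; rewrite -(@integral_pushforward _ _ _ _ _ _ ms mu `[u', v'] (EFin \o f) _ if') //=; last exact/measurable_EFinP.
by apply: eq_measure_integral => A mA _; exact: lebesgue_measure_shift.
Qed.

End LocalIntegrals.

(** * Absolutely continuous functions *)

Section AbsoluteContinuity.
Context {R : realType}.
Local Notation mu := (@lebesgue_measure R).
Implicit Types (f g F : R -> R) (u v w t s a b d e eps : R).

Lemma I_cvg (f_ : nat -> R -> R) f g u v :
  (forall k, loc_int (f_ k)) -> loc_int f -> loc_int g ->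
  {ae mu, forall t, u < t -> t < v -> f_ ^~ t @ \oo --> f t} ->
  {ae mu, forall t, u < t -> t < v -> forall k, `|f_ k t| <= g t} ->
  (fun k => I (f_ k) u v) @ \oo --> I f u v.
Proof.
move=> lf_ lf lg ff fg.
have ae_uv (P : R -> Prop) : {ae mu, forall t, u < t -> t < v -> P t} ->
    {ae mu, forall t : measurableTypeR R, `[u, v]%classic t -> P t}.
  move=> H; have H2 := ae_and (ae_and (ae_neq u) (ae_neq v)) H.
  apply: ae_imp H2 => t [[/eqP tu /eqP tv] h] /=; rewrite in_itv /= => /andP[ut tv'].
  by apply: h; rewrite lt_neqAle ?ut ?tv' andbT // eq_sym.
have [] := @dominated_convergence _ _ _ mu `[u, v]%classic (measurable_itv _)
   (fun k => EFin \o f_ k) (EFin \o f) (EFin \o g).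
- by move=> k; exact: loc_int_emeas.
- exact: loc_int_emeas.
- by apply: ae_imp (ae_uv _ ff) => t h uv; apply: cvg_EFin; [exact: nearW|exact: h].
- exact: lg.
- have := ae_uv _ fg; apply: ae_imp => t h k uv; rewrite /= lee_fin.
  by move: k; exact: h.
- have fin : (\int[mu]_(x in `[u, v]) (EFin \o f) x)%E \is a fin_num.
    by apply: integrable_fin_num => //; exact: lf.
  by move=> _ _; rewrite -(fineK fin) => /fine_cvg.
Qed.

(** [I] integrates over closed intervals, which may share endpoints; these are null, so the
    integrals are taken over the disjoint open intervals instead. *)
Lemma I_sum_disjoint g a b m (u v : 'I_m -> R) : loc_int g ->
  (forall t, 0 <= g t) -> (forall k, a <= u k <= v k /\ v k <= b) ->
  trivIset setT (fun k => `]u k, v k[%classic) ->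
  \sum_(k < m) I g (u k) (v k) <= I g a b.
Proof.
move=> lg g0 uv tuv.
rewrite -lee_fin -sumEFin.
have IE c d : (I g c d)%:E = (\int[mu]_(x in `]c, d[) (g x)%:E)%E.
  rewrite /I /Rintegral fineK; last first.
    by apply: integrable_fin_num => //; exact: lg.
  rewrite (@integral_itv_bndoo _ c d _ true false) //.
  have h := @loc_int_emeas R g c d lg.
  by apply: measurable_funS h => //; exact: subset_itv_oo_cc.
under eq_bigr do rewrite IE.
rewrite IE -ge0_integral_bigsetU //=.
- apply: ge0_subset_integral => //=.
  + by apply: bigsetU_measurable.
  + have h := @loc_int_emeas R g a b lg.
    by apply: measurable_funS h => //; exact: subset_itv_oo_cc.
  + by move=> x _; rewrite lee_fin.
  + rewrite -bigcup_seq => x [k _] /=; have [/andP[au _] vb] := uv k.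
    by rewrite !in_itv /= => /andP[ux xv]; rewrite (le_lt_trans au ux) (lt_le_trans xv vb).
- by rewrite /index_enum; case: index_enum_key; rewrite -enumT; exact: enum_uniq.
- exact: sub_trivIset tuv.
- have h : measurable_fun (`[a, b] : set (measurableTypeR R)) (EFin \o g) := @loc_int_emeas R g a b lg.
  apply: measurable_funS h => //.
  rewrite -bigcup_seq => x [k _] /=; have [/andP[au _] vb] := uv k.
  by rewrite !in_itv /= => /andP[ux xv]; rewrite (ltW (le_lt_trans au ux)) (ltW (lt_le_trans xv vb)).
- by move=> x _; rewrite lee_fin.
Qed.

(** Take for [h] the excess of [g] over [k]: it is dominated by [g] and is 0 at each point for large
    [k], so its integral becomes small. This gives absolute continuity of the integral when [g] is
    unbounded. *)
Lemma trunc_small g a b (eps : R) : loc_int g -> (forall t, 0 <= g t) -> 0 < eps ->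
  exists k : nat, exists h : R -> R, [/\ loc_int h, forall t, 0 <= h t,
    forall t, g t <= k%:R + h t & I h a b < eps].
Proof.
move=> lg g0 e0.
pose h (k : nat) t := Num.max (g t - k%:R) 0.
have lh k : loc_int (h k).
  apply: (@loc_int_dom _ _ g) => //.
    apply: measurable_maxr => //.
    by apply: measurable_funB => //; exact: loc_int_meas.
  apply: aeW => t; rewrite (ger0_norm (g0 t)) ger0_norm ?le_max ?lexx ?orbT //.
  by rewrite ge_max g0 andbT gerBl.
have : (fun k => I (h k) a b) @ \oo --> I (fun _ => 0 : R) a b.
  apply: (@I_cvg h _ g) => //; first exact: loc_int_cst.
    apply: aeW => t _ _; apply: cvg_near_cst.
    exists (Num.trunc (g t)).+1 => // k /= kt.
    rewrite /h; apply/max_idPr; rewrite subr_le0.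
    apply: le_trans (ltW (truncnS_gt (g t))) _.
    by rewrite ler_nat.
  apply: aeW => t _ _ k; rewrite ger0_norm ?le_max ?lexx ?orbT //.
  by rewrite ge_max g0 andbT gerBl.
have -> : I (fun _ => 0 : R) a b = 0 by rewrite /I Rintegral_cst // mul0r.
move=> /cvgrPdist_lt /(_ _ e0) [k _ /(_ k (leqnn k))].
rewrite sub0r normrN => hk; exists k, (h k); split => //.
- by move=> t; rewrite le_max lexx orbT.
- by move=> t; rewrite -lerBlDl le_max lexx.
- by apply: le_lt_trans hk; exact: ler_norm.
Qed.

Lemma AC_bound F g a b : loc_int g -> (forall t, 0 <= g t) ->
  (forall u v, a <= u -> u <= v -> v <= b -> `|F v - F u| <= I g u v) ->
  absolutely_continuous a b F.
Proof.
move=> lg g0 Fg eps e0.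
have e2 : 0 < eps / 2 by rewrite divr_gt0.
have [k [h [lh h0 gh hI]]] := trunc_small a b lg g0 e2.
(* [k] times a total length below this is at most [eps / 2]; [k.+1] avoids division by 0. *)
exists (eps / 2 / k.+1%:R); first by rewrite divr_gt0.
move=> m u v uv tuv suv.
have le1 : \sum_(i < m) `|F (v i) - F (u i)| <=
   \sum_(i < m) (k%:R * (v i - u i) + I h (u i) (v i)).
  apply: ler_sum => i _; have [/andP[au uvi] vb] := uv i.
  apply: (le_trans (Fg _ _ au uvi vb)).
  rewrite -I_cst // -I_D //; last exact: loc_int_cst.
  apply: I_le => //; first by apply: loc_intD => //; exact: loc_int_cst.
  by apply: aeW => t _ _; exact: gh.
apply: (le_lt_trans le1).
rewrite big_split /= -mulr_sumr.
have := I_sum_disjoint lh h0 uv tuv.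
set S1 := \sum_(i < m) (v i - u i) in suv *; set S2 := \sum_(i < m) _ => S2h.
have S10 : 0 <= S1.
  by apply: sumr_ge0 => i _; rewrite subr_ge0; have [/andP[]] := uv i.
have : k%:R * S1 <= eps / 2.
  move: suv; rewrite ltr_pdivlMr // => /ltW; apply: le_trans.
  by rewrite mulrC ler_wpM2l // ler_nat.
lra.
Qed.

Lemma AC_primitive f a b : loc_int f -> absolutely_continuous a b (I f a).
Proof.
move=> lf; apply: (@AC_bound _ (fun t => `|f t|)) => //; first exact: loc_int_norm.
move=> u v au uv vb; rewrite (I_split lf au uv) addrAC subrr add0r.
exact: I_norm.
Qed.

Lemma ACB F G a b : absolutely_continuous a b F -> absolutely_continuous a b G ->
  absolutely_continuous a b (fun t => F t - G t).
Proof.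
move=> aF aG eps e0; have e2 : 0 < eps / 2 by rewrite divr_gt0.
have [d1 d10 H1] := aF _ e2; have [d2 d20 H2] := aG _ e2.
exists (Num.min d1 d2); first by rewrite lt_min d10.
move=> m u v uv tuv; rewrite lt_min => /andP[s1 s2].
have := H1 m u v uv tuv s1; have := H2 m u v uv tuv s2.
have : \sum_(k < m) `|F (v k) - G (v k) - (F (u k) - G (u k))| <=
  \sum_(k < m) (`|F (v k) - F (u k)| + `|G (v k) - G (u k)|).
  apply: ler_sum => k _; apply: le_trans (ler_normB _ _).
  by rewrite le_eqVlt; apply/orP; left; apply/eqP; congr `|_|; ring.
rewrite big_split /=; lra.
Qed.

Lemma AC_lip F G a b : (forall u v, a <= u -> u <= v -> v <= b ->
    `|F v - F u| <= `|G v - G u|) ->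
  absolutely_continuous a b G -> absolutely_continuous a b F.
Proof.
move=> FG aG eps e0; have [d d0 H] := aG _ e0.
exists d => // m u v uv tuv s; apply: le_lt_trans (H m u v uv tuv s).
by apply: ler_sum => k _; have [/andP[au uvk] vb] := uv k; exact: FG.
Qed.

Lemma is_derive_approx F t d : is_derive t 1 F d <->
  forall eps : R, 0 < eps -> exists2 del : R, 0 < del &
    forall v, `|v - t| < del -> `|F v - F t - d * (v - t)| <= eps * `|v - t|.
Proof.
split=> [[dF DF] eps e0|H].
  move: dF; rewrite /derivable => /cvg_ex[l hl].
  have ld : l = d by rewrite -DF; apply/esym/cvg_lim.
  move: hl; rewrite {l}ld => /cvgrPdist_le /(_ _ e0) [del /= del0 Hd].
  exists del => // v vt.
  have [->|vnt] := eqVneq v t; first by rewrite !subrr mulr0 subrr normr0 mulr0.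
  have h0 : v - t != 0 by rewrite subr_eq0.
  have := Hd (v - t); rewrite /ball_ /= sub0r normrN => /(_ vt h0).
  rewrite /= [_%:A]mulr1 subrK -(ler_pM2r (_ : 0 < `|v - t|)) ?normr_gt0 //.
  rewrite -normrM mulrBl /GRing.scale /= mulrAC mulVf // mul1r.
  by rewrite -normrN opprB.
have cv : (h^-1 *: (F (h *: 1 + t) - F t)) @[h --> 0^'] --> d.
  apply/cvgrPdist_le => eps e0; have [del del0 Hd] := H _ e0.
  exists del => // h /=; rewrite sub0r normrN => hd h0.
  have := Hd (h + t); rewrite addrK => /(_ hd).
  rewrite [_%:A]mulr1 => H1.
  rewrite -(ler_pM2r (_ : 0 < `|h|)) ?normr_gt0 //.
  rewrite -normrM mulrBl /GRing.scale /= mulrAC mulVf // mul1r.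
  by rewrite distrC.
split; first by apply/cvg_ex; exists d.
exact: cvg_lim cv.
Qed.

(** Straddle estimate: as [u <= t <= v], the errors at the two ends add up to
    [eps * ((t - u) + (v - t))]. Intervals around [t] are what [cousin] hands out. *)
Lemma is_derive_slope F t d : is_derive t 1 F d -> forall eps : R, 0 < eps ->
  exists2 del : R, 0 < del & forall u v, u <= t -> t <= v -> t - del < u -> v < t + del ->
    `|F v - F u - d * (v - u)| <= eps * (v - u).
Proof.
move=> dF eps e0; have [del del0 H] := (is_derive_approx _ _ _).1 dF _ e0.
exists del => // u v ut tv du dv.
have /H A2 : `|v - t| < del by rewrite ger0_norm ?subr_ge0 //; lra.
have /H A3 : `|u - t| < del by rewrite ler0_norm ?subr_le0 //; lra.
move: A2 A3; rewrite (@ger0_norm _ (v - t)) ?subr_ge0 // (@ler0_norm _ (u - t)) ?subr_le0 //.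
rewrite !ler_norml => /andP[A2 A2'] /andP[A3 A3']; apply/andP; split; nra.
Qed.

Lemma is_derive_I f a : loc_int f ->
  {ae mu, forall t, a < t -> is_derive t 1 (I f a) (f t)}.
Proof.
move=> lf; have := @FTC1 R f (BLeft a) (fun y => lf a y).
have locf : locally_integrable setT f.
  split; [exact: loc_int_meas|exact: openT|move=> K _ cK].
  have [M [Mr KM]] := compact_bounded cK.
  pose M' := `|M| + 1.
  have KM' : K `<=` `[- M', M'].
    move=> x Kx; have /= := KM M' _ x Kx; rewrite ler_norml in_itv /=; apply.
    by rewrite /M' (le_lt_trans (ler_norm M)) // ltrDl.
  have /integrableP[mf] := lf (- M') M'; apply: le_lt_trans.
  apply: ge0_subset_integral => //=; first exact: compact_measurable.
  by apply/measurable_EFinP/measurableT_comp => //; exact: loc_int_meas_itv.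
move=> /(_ locf) /=; apply: ae_imp => t + at_.
rewrite lte_fin => /(_ at_)[dF <-].
by rewrite derive1E; exact: derivableP.
Qed.

(** Cousin's lemma as an induction on intervals. At the supremum of the points reachable from [a],
    the local hypothesis joins a reachable point just below to points above, so the supremum is
    itself reachable and can only be [b]. *)
Lemma cousin (P : R -> R -> Prop) a b : a <= b ->
  (forall u v w, u <= v -> v <= w -> P u v -> P v w -> P u w) ->
  (forall t, a <= t -> t <= b -> exists2 d : R, 0 < d &
     forall u v, a <= u -> u <= t -> t <= v -> v <= b -> t - d < u -> v < t + d -> P u v) ->
  P a b.
Proof.
move=> ab Padd Ploc.
pose S := [set s | [/\ a <= s, s <= b & P a s]].
have Sa : S a.
  have [d d0 H] := Ploc a (lexx a) ab; split => //; apply: H => //; lra.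
have supS : has_sup S by split; [exists a|exists b => s []].
have aS : a <= sup S by apply: ub_le_sup => //; case: supS.
have Sb : sup S <= b by apply: ge_sup; [exists a|move=> s []].
have [d d0 H] := Ploc _ aS Sb.
have [s [as_ sb Pas] sS] : exists2 s, S s & sup S - d < s by exact: sup_adherent.
have ss : s <= sup S by apply: ub_le_sup; [case: supS|].
have step v : sup S <= v -> v <= b -> v < sup S + d -> P a v.
  move=> sv vb vd; apply: (Padd a s v) => //; first exact: le_trans sv.
  by apply: H.
have [->|bS] := eqVneq b (sup S); first by apply: step => //; lra.
have Slt : sup S < b by rewrite lt_neqAle eq_sym bS.
pose v := Num.min b (sup S + d / 2).
have Sv : sup S < v by rewrite lt_min Slt ltrDl divr_gt0.
have vb : v <= b by rewrite ge_min lexx.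
have vd : v < sup S + d by rewrite gt_min; apply/orP; right; lra.
have : v <= sup S.
  apply: ub_le_sup; first by case: supS.
  split => //; first by apply: le_trans aS (ltW Sv).
  by apply: step => //; exact: ltW.
by rewrite leNgt Sv.
Qed.

(* In a tagged partition, the intervals with a good tag contribute at most
   [eps * (b - a)], and those tagged in the null set lie in an open set of small
   measure, where absolute continuity applies. *)
Lemma AC_nonincreasing F a b : a <= b -> absolutely_continuous a b F ->
  {ae mu, forall t, a < t -> t < b -> forall eps : R, 0 < eps -> exists2 d : R, 0 < d &
    forall u v, u <= t -> t <= v -> t - d < u -> v < t + d ->
      F v - F u <= eps * (v - u)} ->
  F b <= F a.
Proof.
move=> ab aF H; apply/ler_addgt0Pr => e e0.
(* Makes [eps * (b - a) + eps] equal to [e]; the 1 covers [a = b]. *)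
pose eps := e / (b - a + 1).
have ba1 : 0 < b - a + 1 by lra.
have eps0 : 0 < eps by rewrite divr_gt0.
have [del del0 Hdel] := aF _ eps0.
(* The endpoints, where nothing is assumed, join the exceptional null set. *)
have [N [mN N0 HN]] := ae_and (ae_and (ae_neq a) (ae_neq b)) H.
have [U [oU NU]] : exists U : set R, [/\ open U, N `<=` U & (mu (U `\` N) < del%:E)%E].
  have Nfin : (mu N < +oo)%E by rewrite N0.
  exact: (@lebesgue_regularity_outer R N del mN Nfin del0).
move=> UN.
have mU : measurable (U : set (measurableTypeR R)) := open_measurable oU.
have muU : (mu U < del%:E)%E.
  have -> : mu U = mu (U `\` N); last by [].
  by rewrite (measureDI mu mU mN) (setIidr NU) [X in (_ + X)%E]N0 adde0.
(* [s] lists the intervals tagged in [N]. Bounding its length by the measure of [U] on a half-open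
   interval makes the bound additive over adjacent intervals, as [cousin] requires. *)
pose P u v := exists s : seq (R * R), [/\
   forall p, p \in s -> u <= p.1 <= p.2 /\ p.2 <= v,
   pairwise (fun p q : R * R => p.2 <= q.1) s,
   ((\sum_(p <- s) (p.2 - p.1))%:E <= mu (U `&` `[u, v[%classic))%E &
   F v - F u <= eps * (v - u) + \sum_(p <- s) `|F p.2 - F p.1| ].
have mUI u v : measurable ((U `&` `[u, v[%classic) : set (measurableTypeR R)).
  exact: measurableI.
have [s [s1 s2 s3 s4]] : P a b.
  apply: cousin => // [u v w uv vw [s [s1 s2 s3 s4]] [r [r1 r2 r3 r4]]|t at_ tb].
    exists (s ++ r); split.
    - move=> p; rewrite mem_cat => /orP[/s1|/r1] [/andP[h1 h2] h3].
        by rewrite h1 h2 (le_trans h3).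
      by rewrite (le_trans uv h1) h2 h3.
    - rewrite pairwise_cat s2 r2 !andbT; apply/allrelP => p q /s1[_ h] /r1[/andP[h' _] _].
      exact: le_trans h h'.
    - have -> : U `&` `[u, w[%classic = (U `&` `[u, v[%classic) `|` (U `&` `[v, w[%classic).
        rewrite -setIUr; congr (_ `&` _); apply: itv_bndbnd_setU; rewrite bnd_simp //.
      rewrite measureU //.
        by rewrite big_cat /= EFinD leeD.
      apply/seteqP; split => x //= [[_ +] [_]]; rewrite !in_itv /= => /andP[_ xv] /andP[vx _].
      by move: (lt_le_trans xv vx); rewrite ltxx.
    - rewrite big_cat /=; lra.
  have [tN|tN] := pselect (N t).
    have [d /= d0 dU] : nbhs t U by apply: open_nbhs_nbhs; split => //; exact: NU.
    exists d => // u v au ut tv vb du dv.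
    have uv : u <= v by exact: le_trans tv.
    exists [:: (u, v)]; split => //=.
    - by move=> p; rewrite inE => /eqP -> /=; rewrite lexx uv.
    - rewrite big_seq1 /= setIidr.
        rewrite lebesgue_measure_itv /= lte_fin; case: ifPn => // uv'.
        rewrite lee_fin; lra.
      move=> x /=; rewrite in_itv /= => /andP[ux xv]; apply: dU.
      rewrite /ball_ /= ltr_norml; lra.
    - rewrite big_seq1 /=; have := ler_norm (F v - F u); have : 0 <= eps * (v - u).
        by rewrite mulr_ge0 ?subr_ge0 // ltW.
      lra.
  have /contrapT [[ta tb'] Ht] := contra_not (HN t) tN.
  have {}at_ : a < t by rewrite lt_neqAle at_ andbT eq_sym; apply/eqP.
  have {}tb : t < b by rewrite lt_neqAle tb andbT; apply/eqP.
  have [d d0 Hd] := Ht at_ tb _ eps0.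
  exists d => // u v au ut tv vb du dv; exists [::]; split => //.
  - by rewrite big_nil; exact: measure_ge0.
  - by rewrite big_nil addr0; exact: Hd.
have := Hdel (size s) (fun k => (tnth (in_tuple s) k).1) (fun k => (tnth (in_tuple s) k).2).
rewrite -(big_tnth _ _ s xpredT (fun p => `|F p.2 - F p.1|)).
rewrite -(big_tnth _ _ s xpredT (fun p => p.2 - p.1)).
have -> : F b <= F a + e = (F b - F a <= e) by rewrite lerBlDl.
have ee : eps * (b - a) + eps = e by rewrite /eps; field; rewrite gt_eqF.
move=> Hs; apply: (le_trans s4); rewrite -[leRHS]ee lerD2l; apply/ltW/Hs.
- by move=> k; apply: s1; exact: mem_tnth.
- have key : forall i j : 'I_(size s), (i < j)%N ->
    (tnth (in_tuple s) i).2 <= (tnth (in_tuple s) j).1.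
    move=> i j ij; rewrite !(tnth_nth (0, 0)) /=.
    by move/(pairwiseP (0, 0)) : s2; apply => //; rewrite ?inE.
  apply/trivIsetP => i j _ _ ij; apply/seteqP; split => x //= [].
  rewrite !in_itv /= => /andP[x1 x2] /andP[x3 x4].
  have : (i < j)%N || (j < i)%N by rewrite -neq_ltn.
  by case/orP => /key h; lra.
- rewrite -lte_fin; apply: le_lt_trans s3 (le_lt_trans _ muU).
  by apply: le_measure => //; rewrite inE.
Qed.

(** The assumption bounds slopes, because it will be applied to [|x - x'|], which can have kinks.
    Subtracting the primitive of [g] reduces it to [AC_nonincreasing]. *)
Lemma AC_le F g a b : a <= b -> absolutely_continuous a b F -> loc_int g ->
  {ae mu, forall t, a < t -> t < b -> forall eps : R, 0 < eps -> exists2 d : R, 0 < d &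
    forall u v, u <= t -> t <= v -> t - d < u -> v < t + d ->
      F v - F u <= (g t + eps) * (v - u)} ->
  F b - F a <= I g a b.
Proof.
move=> ab aF lg H.
suff : F b - I g a b <= F a - I g a a by rewrite I_pt; lra.
apply: (@AC_nonincreasing (fun t => F t - I g a t)) => //.
  by apply: ACB => //; exact: AC_primitive.
apply: ae_imp (ae_and H (is_derive_I a lg)) => t [Ht dI] at_ tb eps e0.
have e2 : 0 < eps / 2 by rewrite divr_gt0.
have [d1 d10 H1] := Ht at_ tb _ e2.
have [d2 d20 H2] := is_derive_slope (dI at_) e2.
exists (Num.min d1 d2); first by rewrite lt_min d10.
move=> u v ut tv tu vt.
have [d1m d2m] : Num.min d1 d2 <= d1 /\ Num.min d1 d2 <= d2.
  by split; rewrite ge_min lexx ?orbT.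
have A1 : F v - F u <= (g t + eps / 2) * (v - u) by apply: H1 => //; lra.
have : `|I g a v - I g a u - g t * (v - u)| <= eps / 2 * (v - u) by apply: H2 => //; lra.
rewrite ler_norml => /andP[A2 _]; lra.
Qed.

Lemma AC_eq F g a b : a <= b -> absolutely_continuous a b F -> loc_int g ->
  {ae mu, forall t, a < t -> t < b -> is_derive t 1 F (g t)} ->
  F b - F a = I g a b.
Proof.
move=> ab aF lg H; apply/eqP; rewrite eq_le; apply/andP; split.
  apply: AC_le => //; apply: ae_imp H => t H at_ tb eps e0.
  have [d d0 Hd] := is_derive_slope (H at_ tb) e0.
  exists d => // u v ut tv du dv; have := Hd u v ut tv du dv.
  rewrite ler_norml => /andP[_]; lra.
have lN : loc_int (fun t => g t * -1) by exact: loc_intZ.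
suff : - F b - - F a <= I (fun t => g t * -1) a b.
  rewrite I_Z //; lra.
apply: (@AC_le (fun t => - F t)) => //.
  by apply: AC_lip aF => u v _ _ _; rewrite -opprD normrN.
apply: ae_imp H => t H at_ tb eps e0.
have [d d0 Hd] := is_derive_slope (H at_ tb) e0.
exists d => // u v ut tv du dv; have := Hd u v ut tv du dv.
rewrite ler_norml => /andP[+ _]; lra.
Qed.

End AbsoluteContinuity.

(** * A single queue: comparison of two inputs *)

Section Queue.
Context {R : realType}.
Local Notation mu := (@lebesgue_measure R).
Implicit Types (f g a b c x : R -> R) (u v s t d e eps : R).

Lemma ACS f s t u v : s <= u -> v <= t -> absolutely_continuous s t f ->
  absolutely_continuous u v f.
Proof.
move=> su vt aF eps e0; have [d d0 H] := aF _ e0.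
exists d => // m p q pq; apply: H => k; have [/andP[up pqk] qv] := pq k.
by rewrite (le_trans su up) pqk (le_trans qv vt).
Qed.

Lemma AC_near f s t eps : absolutely_continuous s t f -> 0 < eps ->
  exists2 d : R, 0 < d & forall u v, s <= u -> u <= v -> v <= t -> v - u < d ->
    `|f v - f u| < eps.
Proof.
move=> aF e0; have [d d0 H] := aF _ e0; exists d => // p q sp pq qt pqd.
have := H 1 (fun _ => p) (fun _ => q); rewrite !big_ord1; apply => //.
  by move=> _; rewrite sp pq.
by apply/trivIsetP => i j _ _; rewrite !ord1 eqxx.
Qed.

Lemma is_derive_near f g t d e : 0 < e ->
  (forall v, `|v - t| < e -> g v - g t = f v - f t) ->
  is_derive t 1 f d -> is_derive t 1 g d.
Proof.
move=> e0 fg /is_derive_approx H; apply/is_derive_approx => eps eps0.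
have [del del0 Hd] := H _ eps0; exists (Num.min del e); first by rewrite lt_min del0.
by move=> v; rewrite lt_min => /andP[v1 v2]; rewrite fg //; exact: Hd.
Qed.

(** [t] is an interior minimum, so the difference quotients on its two sides have opposite signs. *)
Lemma is_derive_min0 x t d : 0 < t -> (forall s, 0 <= s -> 0 <= x s) -> x t = 0 ->
  is_derive t 1 x d -> d = 0.
Proof.
move=> t0 x0 xt /is_derive_approx H; apply/eqP; rewrite -normr_le0.
apply/ler_addgt0Pr => eps e0; rewrite add0r.
have [del del0 Hd] := H _ e0.
(* The bound [t / 2] keeps [t - h] where [x] is known to be nonnegative. *)
pose h := Num.min (del / 2) (t / 2).
have h0 : 0 < h by rewrite lt_min !divr_gt0.
have [h1 h2] : h <= del / 2 /\ h <= t / 2 by split; rewrite ge_min lexx ?orbT.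
have := Hd (t + h); have := Hd (t - h).
have -> : t - h - t = - h by ring.
have -> : t + h - t = h by ring.
rewrite normrN (gtr0_norm h0) xt !subr0.
have hd : h < del by lra.
move=> /(_ hd) + /(_ hd); rewrite !ler_norml => /andP[A1 A2] /andP[A3 A4].
have x1 : 0 <= x (t - h) by apply: x0; lra.
have x2 : 0 <= x (t + h) by apply: x0; lra.
by rewrite -(ler_pM2r h0); apply/andP; split; nra.
Qed.

Lemma gt0_slope (y : R -> R) (r dl k : R) : is_derive r 1 y dl -> 0 < y r -> dl <= k ->
  forall eps : R, 0 < eps -> exists2 d : R, 0 < d &
    forall u v, u <= r -> r <= v -> r - d < u -> v < r + d ->
      `|y v| - `|y u| <= (k + eps) * (v - u).
Proof.
move=> dy yr dlk eps e0; have [d1 d10 H1] := is_derive_slope dy e0.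
have yc : {for r, continuous y}.
  by apply/differentiable_continuous/derivable1_diffP; case: dy.
have [d2 /= d20 H2] : \forall v \near r, `|y r - y v| < y r.
  by move: yc => /cvgrPdist_lt; apply.
have {H2} H2 v : `|v - r| < d2 -> 0 < y v.
  move=> vr; have := H2 v; rewrite /ball_ /= distrC => /(_ vr).
  by rewrite ltr_norml => /andP[_]; clear; lra.
exists (Num.min d1 d2); first by rewrite lt_min d10.
move=> u v ur rv ud vd.
have [d1m d2m] : Num.min d1 d2 <= d1 /\ Num.min d1 d2 <= d2.
  by split; rewrite ge_min lexx ?orbT.
have yv : 0 < y v by apply: H2; rewrite ger0_norm; lra.
have yu : 0 < y u by apply: H2; rewrite ler0_norm; lra.
rewrite (gtr0_norm yv) (gtr0_norm yu).
have : `|y v - y u - dl * (v - u)| <= eps * (v - u) by apply: H1 => //; lra.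
rewrite ler_norml => /andP[_].
have vu : 0 <= v - u by rewrite subr_ge0 (le_trans ur).
have := ler_wpM2r vu dlk; clear; lra.
Qed.

(** The three hypotheses bound the upper slope of the absolute value according to the sign of [y r].
    At a zero, [|y u|] is dropped and [|y v|] is compared with [|dl| * (v - r)], where
    [v - r <= v - u]. *)
Lemma norm_slope (y : R -> R) (r dl k : R) : is_derive r 1 y dl ->
  (0 < y r -> dl <= k) -> (y r < 0 -> - dl <= k) -> (y r = 0 -> `|dl| <= k) ->
  forall eps : R, 0 < eps -> exists2 d : R, 0 < d &
    forall u v, u <= r -> r <= v -> r - d < u -> v < r + d ->
      `|y v| - `|y u| <= (k + eps) * (v - u).
Proof.
move=> dy Hp Hn Hz eps e0.
have [yr0|yr0|yr0] := ltgtP (y r) 0.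
- have dNy : is_derive r 1 (fun t => - y t) (- dl) by exact: is_deriveN.
  have Nyr : 0 < - y r by rewrite oppr_gt0.
  have [d d0 H] := gt0_slope dNy Nyr (Hn yr0) e0.
  by exists d => // u v ? ? ? ?; rewrite -(normrN (y v)) -(normrN (y u)); exact: H.
- exact: gt0_slope (Hp yr0) _ e0.
- have [d d0 H] := is_derive_slope dy e0; exists d => // u v ur rv ud vd.
  have : `|y v - y r - dl * (v - r)| <= eps * (v - r).
    by apply: H; rewrite ?lexx // ltrBlDr ltrDl.
  rewrite yr0 subr0 => h1.
  have h2 : `|y v| <= eps * (v - r) + `|dl| * (v - r).
    rewrite -[y v](subrK (dl * (v - r))) (le_trans (ler_normD _ _)) // lerD //.
    by rewrite normrM (ger0_norm (_ : 0 <= v - r)) // subr_ge0.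
  have vr : 0 <= v - r by rewrite subr_ge0.
  have h3 := ler_wpM2r vr (Hz yr0).
  have h4 : (k + eps) * (v - r) <= (k + eps) * (v - u).
    rewrite ler_wpM2l ?lerD2l ?lerN2 // addr_ge0 ?(ltW e0) //.
    exact: le_trans (Hz yr0).
  have := normr_ge0 (y u); move: h2 h3 h4; clear; lra.
Qed.

(** Apart from integrability, [b] is constrained only at times [t > 0]; its earlier values are
    history. The bounds on [b] are imposed at busy times too, where they follow from [b t = c t]
    once [c] is nonnegative. *)
Definition queue a c x b : Prop :=
  [/\ loc_int b, forall t, 0 <= t -> 0 <= x t,
    forall M : R, 0 <= M -> absolutely_continuous 0 M x &
    {ae mu, forall t, 0 < t ->
      [/\ is_derive t 1 x (a t - b t), 0 < x t -> b t = c t & 0 <= b t <= c t]}].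

Lemma queue_int a c x b s t : loc_int a -> queue a c x b -> 0 <= s -> s <= t ->
  x t - x s = I (fun u => a u - b u) s t.
Proof.
move=> la [lb _ aF H] s0 st; apply: AC_eq => //; last 2 first.
- exact: loc_intB.
- by apply: ae_imp H => u Hu su ut; have [] := Hu (le_lt_trans s0 su).
- by apply: (ACS s0 (lexx t)); apply: aF; exact: le_trans st.
Qed.

(** The integral equation passes to limits, unlike the derivative; absolute continuity and the
    derivative are then recovered from the primitive. *)
Lemma queue_of_int a c x b : loc_int a -> loc_int b ->
  (forall t, 0 <= t -> 0 <= x t) ->
  (forall t, 0 <= t -> x t = x 0 + I (fun u => a u - b u) 0 t) ->
  {ae mu, forall t, 0 < t -> (0 < x t -> b t = c t) /\ 0 <= b t <= c t} ->
  queue a c x b.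
Proof.
move=> la lb x0 xI H; have lab := loc_intB la lb; split => //.
  move=> M M0; apply: (AC_lip _ (AC_primitive 0 M lab)) => u v u0 uv vM.
  by rewrite (xI v) ?(xI u) ?(le_trans u0) // opprD addrACA subrr add0r.
apply: ae_imp (ae_and H (is_derive_I 0 lab)) => t [Ht dI] t0.
have [Ht1 Ht2] := Ht t0; split => //.
apply: (is_derive_near t0 _ (dI t0)) => v vt.
have v0 : 0 <= v by move: vt; rewrite ltr_norml; lra.
by rewrite (xI v) // (xI t) ?(ltW t0) // opprD addrACA subrr add0r.
Qed.

Section Comparison.
Variables (a a' c x x' b b' : R -> R).
Hypotheses (la : loc_int a) (la' : loc_int a').
Hypotheses (q : queue a c x b) (q' : queue a' c x' b').

Lemma queue_contract s t : 0 <= s -> s <= t ->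
  `|x t - x' t| - `|x s - x' s| <= I (fun u => `|a u - a' u| - `|b u - b' u|) s t.
Proof.
move=> s0 st; have [lb x0 aF H] := q; have [lb' x0' aF' H'] := q'.
have aF2 : absolutely_continuous s t (fun u => x u - x' u).
  by apply: ACB; apply: (ACS s0 (lexx t)); [apply: aF|apply: aF']; exact: le_trans st.
apply: (@AC_le _ (fun u => `|x u - x' u|)) => //.
- by apply: AC_lip aF2 => u v _ _ _; exact: ler_dist_dist.
- by apply: loc_intB; apply: loc_int_norm; exact: loc_intB.
apply: ae_imp (ae_and H H') => r [Hr Hr'] sr rt eps e0.
have r0 : 0 < r := le_lt_trans s0 sr.
have [dx bc /andP[b0 bc']] := Hr r0; have [dx' b'c /andP[b'0 b'c']] := Hr' r0.
pose y u := x u - x' u.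
have dy : is_derive r 1 y ((a r - b r) - (a' r - b' r)) by exact: is_deriveB.
have xr0 := x0 r (ltW r0); have xr0' := x0' r (ltW r0).
apply: (norm_slope dy) => // yr.
- have bc2 : b r = c r by apply: bc; move: yr; rewrite /y subr_gt0; exact: le_lt_trans.
  have -> : `|b r - b' r| = b r - b' r by rewrite ger0_norm ?subr_ge0 // bc2.
  have -> : a r - b r - (a' r - b' r) = (a r - a' r) - (b r - b' r) by ring.
  by rewrite lerD2r ler_norm.
- have bc2 : b' r = c r by apply: b'c; move: yr; rewrite /y subr_lt0; exact: le_lt_trans.
  have -> : `|b r - b' r| = b' r - b r by rewrite ler0_norm ?opprB // subr_le0 bc2.
  have -> : - (a r - b r - (a' r - b' r)) = - (a r - a' r) - (b' r - b r) by ring.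
  by rewrite lerD2r -[leRHS]normrN ler_norm.
- have xx' : x r = x' r by apply/eqP; rewrite -subr_eq0; apply/eqP.
  have [xr|xr] := eqVneq (x r) 0.
    have xr' : x' r = 0 by rewrite -xx'.
    have E := is_derive_min0 r0 x0 xr dx.
    have E' := is_derive_min0 r0 x0' xr' dx'.
    have -> : b r - b' r = a r - a' r.
      by move/eqP: E; rewrite subr_eq0 => /eqP <-; move/eqP: E'; rewrite subr_eq0 => /eqP <-.
    by rewrite E E' subrr normr0 subrr.
  (* At a common positive length both queues serve at rate [c r], so the departures agree and only
     the arrivals contribute. *)
  have xr1 : 0 < x r by rewrite lt_neqAle eq_sym xr.
  have xr1' : 0 < x' r by rewrite -xx'.
  rewrite (bc xr1) (b'c xr1') subrr normr0 subr0.
  by rewrite le_eqVlt; apply/orP; left; apply/eqP; congr `|_|; ring.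
Qed.

(** Let A and B be the integrals of [|a - a'|] and [|b - b'|] over [s1, t]. As [x s1 = 0],
    contraction bounds [x t - x' t] by [x' s1] + A - B, and the two balance equations bound it by
    -[x' s1] + A + B. Adding the two cancels [x' s1] and B, neither of which is under control. The
    bound is one-sided; the reverse one uses a zero of [x']. *)
Lemma queue_from_zero s s1 t : 0 <= s -> s <= s1 -> s1 <= t -> x s1 = 0 ->
  x t - x' t <= I (fun u => `|a u - a' u|) s t.
Proof.
move=> s0 ss1 s1t xs1; have s10 := le_trans s0 ss1.
have [lb _ _ _] := q; have [lb' x0' _ _] := q'.
have lA := loc_int_norm (loc_intB la la').
have lB := loc_int_norm (loc_intB lb lb').
have E2 : I (fun u => `|a u - a' u|) s1 t <= I (fun u => `|a u - a' u|) s t.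
  by rewrite (I_split lA ss1 s1t) lerDr I_norm_ge0.
apply: le_trans E2; rewrite -(ler_pM2l (_ : 0 < 2)) //.
have H1 := queue_contract s10 s1t.
have H2 := queue_int la q s10 s1t; have H3 := queue_int la' q' s10 s1t.
rewrite xs1 sub0r normrN (ger0_norm (x0' s1 s10)) (I_B _ _ lA lB) in H1.
rewrite xs1 subr0 in H2.
have H4 := ler_norm (x t - x' t).
have E : I (fun u => a u - b u) s1 t - I (fun u => a' u - b' u) s1 t <=
   I (fun u => `|a u - a' u|) s1 t + I (fun u => `|b u - b' u|) s1 t.
  rewrite -(I_D _ _ lA lB) -(I_B _ _ (loc_intB la lb) (loc_intB la' lb')).
  apply: I_le; [by apply: loc_intB; exact: loc_intB|exact: loc_intD|].
  apply: aeW => u _ _.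
  have -> : a u - b u - (a' u - b' u) = (a u - a' u) + - (b u - b' u) by ring.
  by rewrite lerD // ?ler_norm // -normrN ler_norm.
rewrite -H2 -H3 in E; move: H1 H4 E.
set A := I _ s1 t; set B := I _ s1 t; lra.
Qed.

End Comparison.
End Queue.

(** * A single queue: existence from the empty state *)

Section EmptyQueue.
Context {R : realType}.
Local Notation mu := (@lebesgue_measure R).
Implicit Types (a c f : R -> R) (u v s t d e eps : R).

(** Lindley's formula, that is, the Skorokhod reflection at 0 of the primitive of [f], started empty
    at time 0. For [t < 0] the set is empty and [sup] has the value 0. *)
Definition workload f t := sup [set I f s t | s in `[0, t]].

Section Workload.
Variables (f : R -> R) (lf : loc_int f).
Let X := workload f.
Let V u v := I (fun t => `|f t|) u v.

Let V_split u v w : u <= v -> v <= w -> V u w = V u v + V v w.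
Proof. by move=> uv vw; apply: I_split => //; exact: loc_int_norm. Qed.

Let V_ge0 u v : 0 <= V u v. Proof. exact: I_norm_ge0. Qed.

Let If_V u v : `|I f u v| <= V u v. Proof. exact: I_norm. Qed.

Ltac lra_goal := clear -f lf X V V_split V_ge0 If_V; lra.

Lemma workload_neg t : t < 0 -> X t = 0.
Proof.
move=> t0; rewrite /X /workload set_itv_ge ?image_set0 ?sup0 //.
by rewrite bnd_simp -ltNge.
Qed.

Let has_supX t : 0 <= t -> has_sup [set I f s t | s in `[0, t]].
Proof.
move=> t0; split; first by exists (I f 0 t); exists 0 => //=; rewrite in_itv /= lexx.
exists (V 0 t) => y [s /=]; rewrite in_itv /= => /andP[s0 st] <-.
rewrite (V_split s0 st); apply: le_trans (ler_norm _) _.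
by apply: le_trans (If_V s t) _; rewrite lerDr V_ge0.
Qed.

Lemma le_workload s t : 0 <= s -> s <= t -> I f s t <= X t.
Proof.
move=> s0 st; apply: ub_le_sup; first by case: (has_supX (le_trans s0 st)).
by exists s => //=; rewrite in_itv /= s0.
Qed.

Lemma workload_ge0 t : 0 <= X t.
Proof.
have [t0|t0] := leP 0 t; first by rewrite -(I_pt f t); exact: le_workload.
by rewrite workload_neg.
Qed.

Lemma workload0 : X 0 = 0.
Proof.
apply/eqP; rewrite eq_le workload_ge0 andbT; apply: ge_sup.
  by exists (I f 0 0); exists 0 => //=; rewrite in_itv /= lexx.
by move=> y [s /=]; rewrite in_itv /= -eq_le => /eqP <- <-; rewrite I_pt.
Qed.

Lemma workload_lower u v : 0 <= u -> u <= v -> X u + I f u v <= X v.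
Proof.
move=> u0 uv; rewrite -lerBrDr; apply: ge_sup; first by case: (has_supX u0).
move=> y [s /=]; rewrite in_itv /= => /andP[s0 su] <-.
by rewrite lerBrDr -I_split //; apply: le_workload => //; exact: le_trans uv.
Qed.

(** Start times before [u] contribute at most [X u + I f u v]; those after [u] are bounded
    separately. With [workload_lower] this makes the workload at [v] computable from the one at
    [u]. *)
Lemma workload_upper u v m : 0 <= u -> u <= v -> X u + I f u v <= m ->
  (forall s, u <= s -> s <= v -> I f s v <= m) -> X v <= m.
Proof.
move=> u0 uv Xm sm; apply: ge_sup; first by case: (has_supX (le_trans u0 uv)).
move=> y [s /=]; rewrite in_itv /= => /andP[s0 sv] <-.
have [us|su] := leP u s; first exact: sm.
rewrite (I_split lf (ltW su) uv); apply: le_trans Xm.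
by rewrite lerD2r; apply: le_workload => //; exact: ltW.
Qed.

Lemma workload_var u v : u <= v -> `|X v - X u| <= V u v.
Proof.
move=> uv.
have key w : 0 <= w -> w <= v -> `|X v - X w| <= V w v.
  move=> w0 wv; have := If_V w v; rewrite !ler_norml => /andP[h1 h2].
  have h3 := workload_lower w0 wv.
  apply/andP; split; first by move: h1 h3; lra_goal.
  rewrite lerBlDr; apply: (workload_upper w0 wv); first by rewrite addrC lerD2r.
  move=> s ws sv; apply: (le_trans (ler_norm _)); apply: (le_trans (If_V _ _)).
  rewrite (V_split ws sv).
  by have := V_ge0 w s; have := workload_ge0 w; lra_goal.
have [u0|u0] := leP 0 u; first exact: key.
rewrite (workload_neg u0) subr0.
have [v0|v0] := leP 0 v; last by rewrite workload_neg // normr0 V_ge0.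
have := key 0 (lexx _) v0; rewrite workload0 subr0 => h.
by apply: le_trans h _; rewrite (V_split (ltW u0) v0) lerDr V_ge0.
Qed.

Lemma workload_AC s t : absolutely_continuous s t X.
Proof.
apply: (@AC_bound _ _ (fun t => `|f t|)) => //; first exact: loc_int_norm.
by move=> u v _ uv _; exact: workload_var.
Qed.

Lemma workload_continuous : continuous X.
Proof.
move=> t; apply/cvgrPdist_lt => e e0.
pose t' : R := t.
have [d d0 H] := AC_near (@workload_AC (t' - 1) (t' + 1)) e0.
exists (Num.min d 1) => [|v]; first by rewrite /= lt_min d0 ltr01.
rewrite /ball_ /= lt_min => /andP[w1 w2].
rewrite ltr_norml in w1; rewrite ltr_norml in w2.
move/andP: w1 => [v1 v2]; move/andP: w2 => [v3 v4].
have [tv|vt] := leP t v.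
  by rewrite distrC; apply: H; rewrite /t' //; move: v1 v2 v3 v4; lra_goal.
by apply: H; rewrite /t' ?(ltW vt) //; move: v1 v2 v3 v4; lra_goal.
Qed.

(** If [X t > 0], then near [t] the integral of [|f|] is too small for a start time that close to
    attain the supremum, so [X] moves with the primitive of [f]. If [X t = 0], every [I f s t] is
    nonpositive, which forces [f t <= 0], and [X] varies no more than the primitive of [|f|]; this
    linear bound replaces a derivative. *)
Lemma workload_derive : {ae mu, forall t, 0 < t ->
  (0 < X t -> is_derive t 1 X (f t)) /\
  (X t = 0 -> f t <= 0 /\ exists k : R, exists2 d : R, 0 < d &
     forall v, `|v - t| < d -> X v <= k * `|v - t|)}.
Proof.
have H := ae_and (is_derive_I 0 lf) (is_derive_I 0 (loc_int_norm lf)).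
apply: ae_imp H => t [Hf HV] t0.
have {}Hf := Hf t0; have {}HV := HV t0.
pose k := `|f t| + 1.
have k0 : 0 < k by rewrite ltr_pwDr.
have [dV dV0 HdV] := is_derive_slope HV (ltr01 : 0 < 1 :> R).
have Vk u v : 0 <= u -> u <= t -> t <= v -> t - dV < u -> v < t + dV ->
    V u v <= k * (v - u).
  move=> u0 ut tv ud vd; have := HdV u v ut tv ud vd.
  have -> : I (fun t => `|f t|) 0 v - I (fun t => `|f t|) 0 u = V u v.
    by rewrite (I_split (loc_int_norm lf) u0 (le_trans ut tv)) addrAC subrr add0r.
  by rewrite ler_norml /k => /andP[_]; lra_goal.
split=> [X0|X0].
  (* Within [d] of [t] the variation [V] is at most [X t / 2]; the bound [d <= t] keeps [v]
     nonnegative. *)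
  pose d := Num.min (Num.min dV t) (X t / (2 * k)).
  have d0 : 0 < d by rewrite !lt_min dV0 t0 divr_gt0 // mulr_gt0.
  have [[d1 d2] d3] : (d <= dV /\ d <= t) /\ d <= X t / (2 * k).
    by rewrite /d !ge_min !lexx !orbT.
  have dk : k * d <= X t / 2.
    move: d3; rewrite ler_pdivlMr ?mulr_gt0 //; lra_goal.
  apply: (is_derive_near d0 _ Hf) => v vt.
  have [tv|vt'] := leP t v.
    have Vtv : V t v <= X t / 2.
      apply: le_trans dk; apply: (le_trans (Vk t v _ _ _ _ _)) => //; first exact: ltW.
      - by move: dV0; lra_goal.
      - by move: vt d1; rewrite ger0_norm ?subr_ge0 //; lra_goal.
      - by rewrite ler_pM2l //; move: vt; rewrite ger0_norm ?subr_ge0 //; lra_goal.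
    rewrite (I_split lf (ltW t0) tv) addrAC subrr add0r.
    apply/eqP; rewrite eq_le; apply/andP; split; last first.
      by have := workload_lower (ltW t0) tv; rewrite -/X; lra_goal.
    rewrite lerBlDr addrC; apply: (workload_upper (ltW t0) tv) => // s ts sv.
    rewrite (I_split lf ts sv) addrA lerDr.
    have := If_V t s; rewrite ler_norml => /andP[h _].
    move: Vtv; rewrite (V_split ts sv); have := V_ge0 s v.
    move: h X0; lra_goal.
  have v0 : 0 <= v.
    by move: vt d2; rewrite ltr0_norm ?subr_lt0 //; lra_goal.
  have Vtv : V v t <= X t / 2.
    apply: le_trans dk; apply: (le_trans (Vk v t _ _ _ _ _)) => //; first exact: ltW.
    - by move: vt d1; rewrite ltr0_norm ?subr_lt0 //; lra_goal.
    - by move: dV0; lra_goal.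
    - by rewrite ler_pM2l //; move: vt; rewrite ltr0_norm ?subr_lt0 //; lra_goal.
  rewrite (I_split lf v0 (ltW vt')).
  suff : X t - X v = I f v t by lra_goal.
  apply/eqP; rewrite eq_le; apply/andP; split; last first.
    by have := workload_lower v0 (ltW vt'); rewrite -/X; lra_goal.
  rewrite lerBlDr addrC; apply: (workload_upper v0 (ltW vt')) => // s ts sv.
  rewrite (I_split lf ts sv) addrA lerDr.
  have := If_V v s; rewrite ler_norml => /andP[h _].
  have := workload_var (ltW vt'); rewrite -/X -/(V _ _) ler_norml => /andP[_ h'].
  move: Vtv h'; rewrite (V_split ts sv); have := V_ge0 s t.
  move: h X0; lra_goal.
split.
  apply/ler_addgt0Pr => e e0; rewrite add0r.
  have [d d0 Hd] := is_derive_slope Hf e0.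
  pose h := Num.min (d / 2) t.
  have h0 : 0 < h by rewrite lt_min t0 divr_gt0.
  have [h1 h2] : h <= d / 2 /\ h <= t by rewrite /h !ge_min !lexx !orbT.
  have th0 : 0 <= t - h by rewrite subr_ge0.
  have tht : t - h <= t by rewrite gerBl ltW.
  have := Hd (t - h) t tht (lexx t); rewrite (I_split lf th0 tht).
  have := le_workload th0 tht; rewrite -/X X0.
  have -> : t - (t - h) = h by ring.
  have td : t - d < t - h by move: h1 d0; lra_goal.
  rewrite ltrDl => h3 /(_ td d0); rewrite ler_norml => /andP[h4 _].
  rewrite -(ler_pM2r h0); move: h3 h4; lra_goal.
exists k; exists (Num.min dV t); first by rewrite lt_min dV0.
move=> v; rewrite lt_min => /andP[vd vt].
have [tv|vt'] := leP t v.
  move: vd vt; rewrite ger0_norm ?subr_ge0 // => vd vt.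
  have := workload_var tv; rewrite -/X X0 subr0 (ger0_norm (workload_ge0 v)).
  move=> h; apply: (le_trans h); apply: Vk => //; first exact: ltW.
    by move: dV0; lra_goal.
  by move: vd; lra_goal.
move: vd vt; rewrite ltr0_norm ?subr_lt0 // opprB => vd vt.
have := workload_var (ltW vt'); rewrite -/X X0 sub0r normrN (ger0_norm (workload_ge0 v)).
move=> h; apply: (le_trans h); apply: Vk => //; first by move: vt; lra_goal.
- exact: ltW.
- by move: vd; lra_goal.
- by move: dV0; lra_goal.
Qed.

End Workload.

(* Where the queue is empty [min a c] is almost everywhere [a], but unlike [a] it
   satisfies [outflow <= c] at every point. *)
Definition outflow a c t :=
  if 0 < workload (fun u => a u - c u) t then c t else Num.min (a t) (c t).

(** Causality is what allows the network to be built in steps of the least travel time. *)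
Lemma outflow_causal a a' c t : (forall s, s <= t -> a s = a' s) ->
  outflow a c t = outflow a' c t.
Proof.
move=> aa'; rewrite /outflow aa' //.
suff -> : workload (fun u => a u - c u) t = workload (fun u => a' u - c u) t by [].
rewrite /workload; congr sup; apply: eq_imagel => s; rewrite /= in_itv /= => /andP[_ st].
by apply: eq_I => u su ut; rewrite aa'.
Qed.

Section SquareDerivative.
Variables (x : R -> R) (t d : R).
Hypothesis x0 : forall s, 0 <= x s.
Hypothesis dx : 0 < x t -> is_derive t 1 x d.
Hypothesis lip : x t = 0 -> exists k : R, exists2 del : R, 0 < del &
  forall v, `|v - t| < del -> x v <= k * `|v - t|.

(* [z ^ 2 / (z + e)] tends to [z] as [e -> 0] and has a double zero at [0], so that
   its composition with [x] is differentiable even where [x] vanishes with a kink. *)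
Lemma is_derive_sqr_div e : 0 < e ->
  is_derive t 1 (fun s => x s * x s / (x s + e))
    (x t * (x t + 2 * e) / (x t + e) ^+ 2 * d).
Proof.
move=> e0; have xe s : 0 < x s + e by rewrite ltr_wpDl.
have [xt|xt] := eqVneq (x t) 0.
  apply/is_derive_approx => eps eps0; rewrite xt !mul0r.
  have [k [del del0 H]] := lip xt.
  pose K := `|k| + 1; have K0 : 0 < K by rewrite ltr_pwDr.
  (* On this range [x v * x v] is at most [K ^+ 2 * |v - t| ^+ 2], hence at most
     [eps * e * |v - t|], and the denominator [x v + e] is at least [e]. *)
  exists (Num.min del (eps * e / K ^+ 2)).
    by rewrite lt_min del0 divr_gt0 ?mulr_gt0 ?exprn_gt0.
  move=> v; rewrite lt_min => /andP[v1 v2]; rewrite subr0 mul0r subr0.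
  have h1 : x v <= K * `|v - t|.
    apply: (le_trans (H v v1)); rewrite ler_wpM2r //.
    by rewrite (le_trans (ler_norm k)) // lerDl.
  rewrite ger0_norm; last by rewrite divr_ge0 ?mulr_ge0 // ltW.
  rewrite ler_pdivrMr //.
  have h2 : x v * x v <= (K * `|v - t|) * (K * `|v - t|) by apply: ler_pM.
  have h3 : K ^+ 2 * `|v - t| <= eps * e.
    by move: v2; rewrite ltr_pdivlMr ?exprn_gt0 // mulrC => /ltW.
  apply: (le_trans h2).
  have -> : (K * `|v - t|) * (K * `|v - t|) = (K ^+ 2 * `|v - t|) * `|v - t| by ring.
  apply: (le_trans (ler_wpM2r (normr_ge0 _) h3)).
  rewrite mulrAC ler_wpM2l ?mulr_ge0 ?(ltW eps0) //.
  by rewrite lerDr.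
have xt0 : 0 < x t by rewrite lt_neqAle eq_sym xt x0.
have D := dx xt0.
have De : is_derive t 1 (fun s => x s + e) d.
  by have := is_deriveD D (is_derive_cst e t (1 : R)); rewrite addr0.
have DV := @is_deriveV _ (fun s => x s + e) t d 1 (lt0r_neq0 (xe t)) De.
have DM : is_derive t 1 (fun s => x s * x s / (x s + e)) _ := is_deriveM (is_deriveM D D) DV.
apply: (is_derive_eq DM).
have {DM} p0 : x t + e != 0 by rewrite gt_eqF.
move: p0; set p := x t => p0.
transitivity (p * p * (- ((p + e) ^+ 2)^-1 * d) + (p + e)^-1 * (p * d + p * d)); first by [].
by field.
Qed.

End SquareDerivative.

(** The difference quotient is [1 - e ^+ 2 / ((p + e) * (q + e))], which lies between 0 and 1.
    Composition with this function therefore keeps absolute continuity. *)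
Lemma sqr_div_lip (e p q : R) : 0 < e -> 0 <= p -> 0 <= q ->
  `|p * p / (p + e) - q * q / (q + e)| <= `|p - q|.
Proof.
move=> e0 p0 q0; have pe : 0 < p + e by lra.
have qe : 0 < q + e by lra.
have -> : p * p / (p + e) - q * q / (q + e) =
   (p - q) * ((p * q + e * (p + q)) / ((p + e) * (q + e))).
  by field; rewrite !gt_eqF.
rewrite normrM ler_piMr //.
have n0 : 0 <= p * q + e * (p + q) by nra.
rewrite ger0_norm ?divr_ge0 ?mulr_ge0 // ?(ltW pe) ?(ltW qe) //.
rewrite ler_pdivrMr ?mulr_gt0 // mul1r; nra.
Qed.

Lemma harmonic_addr (p : R) : (fun k : nat => p + k.+1%:R^-1) @ \oo --> p.
Proof.
by rewrite -[X in _ --> X]addr0; apply: cvgD; [exact: cvg_cst|exact: cvg_harmonic].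
Qed.

Lemma sqr_div_cvg (p : R) : 0 <= p ->
  (fun k : nat => p * p / (p + k.+1%:R^-1)) @ \oo --> p.
Proof.
rewrite le_eqVlt => /orP[/eqP <-|p0].
  by under eq_fun do rewrite !mul0r; exact: cvg_cst.
rewrite -[X in _ --> X](mulfK (lt0r_neq0 p0)).
apply: cvgM; first exact: cvg_cst.
by apply: cvgV; [exact: lt0r_neq0|exact: harmonic_addr].
Qed.

Lemma dsqr_div_cvg (p : R) : 0 < p ->
  (fun k : nat => p * (p + 2 * k.+1%:R^-1) / (p + k.+1%:R^-1) ^+ 2) @ \oo --> (1 : R).
Proof.
move=> p0; have p20 : p ^+ 2 != 0 by rewrite expf_neq0 // gt_eqF.
rewrite -[X in _ --> X](mulfV p20); apply: cvgM.
  rewrite expr2; apply: cvgM; first exact: cvg_cst.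
  rewrite -[X in _ --> X]addr0; apply: cvgD; first exact: cvg_cst.
  by rewrite -[X in _ --> X](mulr0 2); apply: cvgM; [exact: cvg_cst|exact: cvg_harmonic].
by apply: cvgV => //; rewrite expr2; apply: cvgM; exact: harmonic_addr.
Qed.

Section WorkloadIntegral.
Variables (f : R -> R) (lf : loc_int f).
Let X := workload f.
(** The derivative of [z * z / (z + e)] at [z = X t]. It lies in [0, 1]; as [e] tends to 0 it tends
    to 1 where [X t > 0], and it is 0 where [X t = 0]. *)
Let dphi e t := X t * (X t + 2 * e) / (X t + e) ^+ 2.

Let measX : measurable_fun setT X.
Proof. by apply: continuous_measurable_fun; exact: workload_continuous. Qed.

Let Xe e t : 0 < e -> 0 < X t + e.
Proof. by move=> e0; rewrite ltr_wpDl // workload_ge0. Qed.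

Let dphi_ge0 e t : 0 < e -> 0 <= dphi e t.
Proof.
move=> e0; have X0 := workload_ge0 lf t.
by rewrite divr_ge0 ?sqr_ge0 // mulr_ge0 // addr_ge0 // mulr_ge0 // ltW.
Qed.

Let dphi_le1 e t : 0 < e -> dphi e t <= 1.
Proof.
move=> e0; rewrite ler_pdivrMr ?exprn_gt0 ?Xe // mul1r.
rewrite sqrrD -subr_ge0.
have -> : X t ^+ 2 + X t * e *+ 2 + e ^+ 2 - X t * (X t + 2 * e) = e ^+ 2 by ring.
exact: sqr_ge0.
Qed.

Let loc_int_dphi e : 0 < e -> loc_int (fun t => dphi e t * f t).
Proof.
move=> e0; apply: (loc_int_dom _ lf).
  apply: measurable_funM; last exact: loc_int_meas.
  have cX := workload_continuous lf.
  apply: continuous_measurable_fun => t.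
  apply: cvgM.
    by apply: cvgM; [exact: cX|apply: cvgD; [exact: cX|exact: cvg_cst]].
  have cXe : X x + e @[x --> t] --> X t + e by apply: cvgD; [exact: cX|exact: cvg_cst].
  by apply: cvgV; [rewrite expf_neq0 // gt_eqF // Xe|rewrite expr2; exact: cvgM].
apply: aeW => t; rewrite normrM ler_piMl // ger0_norm ?dphi_le1 //.
exact: dphi_ge0.
Qed.

Let phi_integral e t : 0 < e -> 0 <= t ->
  X t * X t / (X t + e) = I (fun s => dphi e s * f s) 0 t.
Proof.
move=> e0 t0.
have := @AC_eq _ (fun s => X s * X s / (X s + e)) (fun s => dphi e s * f s) 0 t t0.
rewrite /X (workload0 lf) !mul0r subr0; apply.
- apply: (AC_lip _ (workload_AC lf 0 t)) => u v _ _ _.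
  by apply: sqr_div_lip => //; exact: workload_ge0.
- exact: loc_int_dphi.
- apply: ae_imp (workload_derive lf) => s Hs s0 _.
  have [H1 H2] := Hs s0.
  apply: is_derive_sqr_div => //; first by move=> u; exact: workload_ge0.
  by move=> /H2 [].
Qed.

Lemma loc_int_busy : loc_int (fun t => if 0 < X t then f t else 0).
Proof.
apply: (loc_int_dom _ lf).
  apply: measurable_fun_ifT => //; last exact: loc_int_meas.
  by apply: measurable_fun_ltr.
apply: aeW => t; case: ifP => // _.
by rewrite normr0.
Qed.

(** At zeros of [X] only a linear bound is known, so the identity is proved for [X * X / (X + e)],
    which is differentiable almost everywhere, and [e = 1 / (k + 1)] tends to 0 under the dominating
    function [|f|]. The factors [dphi] become the indicator of busy times. *)
Lemma workload_integral t : 0 <= t ->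
  X t = I (fun s => if 0 < X s then f s else 0) 0 t.
Proof.
move=> t0.
have e0 k : 0 < (k.+1%:R)^-1 :> R by rewrite invr_gt0.
have lim1 : (fun k => I (fun s => dphi k.+1%:R^-1 s * f s) 0 t) @ \oo -->
    I (fun s => if 0 < X s then f s else 0) 0 t.
  apply: (@I_cvg _ _ _ (fun t => `|f t|)) => //.
  - by move=> k; exact: loc_int_dphi.
  - exact: loc_int_busy.
  - exact: loc_int_norm.
  - apply: aeW => s _ _; case: ifPn => [Xs|Xs]; last first.
      have X0 : X s = 0 by apply/eqP; rewrite eq_le workload_ge0 // leNgt Xs.
      by under eq_fun do rewrite /dphi X0 !mul0r; exact: cvg_cst.
    rewrite -[f s in X in _ --> X]mul1r; apply: cvgMl; exact: dsqr_div_cvg.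
  - apply: aeW => s _ _ k; rewrite normrM ler_piMl // ger0_norm ?dphi_le1 //.
    exact: dphi_ge0.
have lim2 : (fun k => I (fun s => dphi k.+1%:R^-1 s * f s) 0 t) @ \oo --> X t.
  under eq_fun do rewrite -phi_integral //.
  apply: sqr_div_cvg; exact: workload_ge0.
exact: (cvg_unique _ lim2 lim1).
Qed.

End WorkloadIntegral.

Lemma loc_int_outflow a c : loc_int a -> loc_int c ->
  (forall t, 0 <= a t) -> (forall t, 0 <= c t) -> loc_int (outflow a c).
Proof.
move=> la lc a0 c0; have lf := loc_intB la lc.
apply: (loc_int_dom _ lc).
  apply: measurable_fun_ifT.
  - apply: measurable_fun_ltr => //.
    by apply: continuous_measurable_fun; exact: workload_continuous.
  - exact: loc_int_meas.
  - by apply: measurable_minr; exact: loc_int_meas.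
apply: aeW => t; rewrite (ger0_norm (c0 t)) /outflow; case: ifP => _.
  by rewrite ger0_norm.
by rewrite ger0_norm ?le_min ?a0 ?c0 // ge_min lexx orbT.
Qed.

(** Almost everywhere on the zero set [workload_derive] gives [a <= c], so the outflow there is [a]
    and the net inflow is the busy integrand of [workload_integral]. *)
Lemma queue_empty a c : loc_int a -> loc_int c ->
  (forall t, 0 <= a t) -> (forall t, 0 <= c t) ->
  queue a c (workload (fun u => a u - c u)) (outflow a c).
Proof.
move=> la lc a0 c0; have lf := loc_intB la lc.
have lo := loc_int_outflow la lc a0 c0.
apply: queue_of_int => //.
- by move=> t _; exact: workload_ge0.
- move=> t t0; rewrite (workload0 lf) add0r (workload_integral lf t0).
  have lb : loc_int (fun s => if 0 < workload (fun u => a u - c u) s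
      then a s - c s else 0).
    exact: loc_int_busy.
  apply: I_eq_ae => //; first exact: loc_intB.
  apply: ae_imp (workload_derive lf) => s Hs s0 _; rewrite /outflow.
  case: ifPn => // Xs; have [_ /(_ _)[]] := Hs s0.
    by apply/eqP; rewrite eq_le workload_ge0 // leNgt Xs.
  rewrite subr_le0 => /min_idPl -> _; by rewrite subrr.
- apply: aeW => t t0; rewrite /outflow; split=> [->//|].
  case: ifP => _; first by rewrite c0 lexx.
  by rewrite le_min a0 c0 ge_min lexx orbT.
Qed.

End EmptyQueue.

(** * The network *)

Section Network.
Context {R : realType} {n : nat}.
Local Notation mu := (@lebesgue_measure R).
Implicit Types (x b : 'I_n -> R -> R) (u v s t : R).

Lemma I_mono (g : R -> R) u v u' v' : loc_int g -> (forall t, 0 <= g t) ->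
  u <= u' -> u' <= v' -> v' <= v -> I g u' v' <= I g u v.
Proof.
move=> lg g0 uu' uv vv'.
have ge0 p q : 0 <= I g p q by apply: I_ge0 => //; apply: aeW.
rewrite (I_split lg uu' (le_trans uv vv')) (I_split lg uv vv').
by rewrite addrCA lerDl addr_ge0.
Qed.

(** A sequence of bounded variation is a difference of bounded monotone ones, here [y + U] and [U].
    The bound on [y + U] comes from [y - U] being nonincreasing. *)
Lemma cvg_of_step (y U : nat -> R) (B : R) : (forall k, `|y k.+1 - y k| <= U k.+1 - U k) ->
  (forall k, U k <= B) -> cvgn y.
Proof.
move=> yU UB.
have Ucvg : cvgn U.
  apply: nondecreasing_is_cvgn; last by exists B => _ [k _ <-].
  by apply/nondecreasing_seqP => k; rewrite -subr_ge0; exact: le_trans (yU k).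
have yUcvg : cvgn (fun k => y k + U k).
  apply: nondecreasing_is_cvgn.
    apply/nondecreasing_seqP => k; rewrite -subr_ge0.
    by have := yU k; rewrite ler_norml => /andP[+ _]; lra.
  exists (y 0%N - U 0%N + B + B) => _ [k _ <-].
  have : y k - U k <= y 0%N - U 0%N.
    elim: k => [//|k]; apply: le_trans.
    by have := yU k; rewrite ler_norml => /andP[_]; lra.
  by have := UB k; lra.
have -> : y = (fun k => (y k + U k) - U k) by apply/funext => k; rewrite addrK.
exact: is_cvgB.
Qed.

(** Integrated over one period [qT, (q+1)T], the series over [k] is the integral of [g] over the
    half-line from qT, which is at most [K]; so the series is finite almost everywhere on that
    period. *)
Lemma ae_partial_sums (g : R -> R) (T K : R) : 0 < T -> loc_int g -> (forall t, 0 <= g t) ->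
  (forall t, 0 <= t -> I g 0 t <= K) ->
  {ae mu, forall t, 0 < t -> exists B : R, forall m : nat,
    \sum_(0 <= k < m) g (t + k%:R * T) <= B}.
Proof.
move=> T0 lg g0 HK.
have lgs s : loc_int (fun t => g (t + s)).
  by have := loc_int_shift (- s) lg; under eq_fun do rewrite opprK.
have translate s u v : I (fun t => g (t + s)) u v = I g (u + s) (v + s).
  by have := @I_shift _ g (- s) u v lg; rewrite !opprK => <-.
suff key : forall q : nat, {ae mu, forall t, q%:R * T <= t -> t <= q.+1%:R * T ->
    exists B : R, forall m : nat, \sum_(0 <= k < m) g (t + k%:R * T) <= B}.
  apply: ae_imp (ae_foralln key) => t Ht t0; apply: (Ht (Num.trunc (t / T))).
    by rewrite -ler_pdivlMr // truncn_le divr_ge0 // ltW.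
  by rewrite -ler_pdivrMr //; apply/ltW/truncnS_gt.
move=> q; pose E : set (measurableTypeR R) := `[q%:R * T, q.+1%:R * T]%classic.
have mE : measurable E by exact: measurable_itv.
pose F (k : nat) (t : measurableTypeR R) := (g (t + k%:R * T))%:E.
have mF k : measurable_fun E (F k) by exact: loc_int_emeas.
have F0 k t : (0 <= F k t)%E by rewrite lee_fin.
pose G t := (\sum_(k <oo) F k t)%E.
have mG : measurable_fun E G.
  by apply: ge0_emeasurable_sum => // k t _ _; exact: F0.
have G0 t : (0 <= G t)%E by apply: nneseries_ge0.
have IF k : (\int[mu]_(t in E) F k t)%E =
    (I g ((q + k)%:R * T) ((q + k).+1%:R * T))%:E.
  rewrite -addSn !natrD !mulrDl -translate /I /Rintegral fineK //.
  by apply: integrable_fin_num => //; exact: lgs.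
have qk (k l : nat) : (k <= l)%N -> k%:R * T <= l%:R * T.
  by move=> kl; rewrite ler_pM2r // ler_nat.
have IG : (\int[mu]_(t in E) G t <= K%:E)%E.
  rewrite integral_nneseries //.
  apply: lime_le; first by apply: is_cvg_nneseries => k _ _; apply: integral_ge0.
  apply: nearW => m; under eq_bigr do rewrite IF.
  rewrite sumEFin lee_fin; apply: le_trans (HK ((q + m)%:R * T) _); last first.
    by rewrite mulr_ge0 // ltW.
  rewrite (@I_split _ g 0 (q%:R * T) _ lg) ?mulr_ge0 ?(ltW T0) ?qk ?leq_addr //.
  apply: le_trans (_ : _ <= I g (q%:R * T) ((q + m)%:R * T)) _; last first.
    by rewrite lerDr I_ge0 //; exact: aeW.
  elim: m => [|m IH]; first by rewrite big_geq // addn0 I_pt.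
  rewrite big_nat_recr //= addnS.
  rewrite (@I_split _ g (q%:R * T) ((q + m)%:R * T) ((q + m).+1%:R * T)) ?qk ?leq_addr //.
  by rewrite lerD2r.
have intG : mu.-integrable E G.
  apply/integrableP; split => //; apply: le_lt_trans (ltry K).
  by under eq_integral do rewrite gee0_abs //.
apply: ae_imp (integrable_ae mE intG) => t Gt qt tq.
have {}Gt : G t \is a fin_num by apply: Gt; rewrite /E /= in_itv /= qt tq.
exists (fine (G t)) => m; rewrite -lee_fin fineK // -sumEFin.
exact: (@nneseries_lim_ge _ (fun k => F k t) xpredT 0%N m).
Qed.

Variables (r : 'M[R]_n) (tau : 'I_n -> 'I_n -> R) (e c : 'I_n -> R -> R).
Hypotheses (r0 : forall i j, 0 <= r i j) (tau0 : forall i j, 0 < tau i j).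
Hypotheses (le : forall i, loc_int (e i)) (lc : forall i, loc_int (c i)).
Hypotheses (e0 : forall i t, 0 <= e i t) (c0 : forall i t, 0 <= c i t).
Hypothesis c_neg : forall i t, t < 0 -> c i t = 0.

Definition arrival b i t := e i t + \sum_(j < n) b j (t - tau j i) * r j i.

Definition net x b := forall i, queue (arrival b i) (c i) (x i) (b i).

Lemma loc_int_arrival b i : (forall j, loc_int (b j)) -> loc_int (arrival b i).
Proof.
move=> lb; apply: loc_intD => //; apply: loc_int_sum => j.
by apply: loc_intZ; exact: loc_int_shift.
Qed.

Lemma min_travel_time : exists2 d : R, 0 < d & forall i j, d <= tau i j.
Proof.
pose T := ('I_n * 'I_n)%type.
exists (\big[Num.min/1]_(p : T) tau p.1 p.2).
  by elim/big_ind : _ => // a a' a0 a0'; rewrite lt_min a0.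
by move=> i j; rewrite (bigD1 (i, j)) //= ge_min lexx.
Qed.

(** * Existence of one trajectory, in steps of the least travel time *)

Section Existence.
Variables (d : R) (d0 : 0 < d) (dtau : forall i j, d <= tau i j).

(** Picard iteration. Each round of [outflow] reads departures at least [d] old, so the k-th iterate
    is final before time [k * d]. *)
Fixpoint departure_iter (k : nat) : 'I_n -> R -> R :=
  if k is k'.+1 then fun i => outflow (arrival (departure_iter k') i) (c i)
  else fun _ _ => 0.
Let B := departure_iter.

Let arr_ge0 b i t : (forall j s, 0 <= b j s) -> 0 <= arrival b i t.
Proof. by move=> b0; rewrite addr_ge0 // sumr_ge0 // => j _; rewrite mulr_ge0. Qed.

Let B_bounds k i t : 0 <= B k i t <= c i t.
Proof.
elim: k i t => [|k IH] i t /=; first by rewrite lexx c0.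
rewrite /outflow; case: ifP => _; first by rewrite c0 lexx.
rewrite le_min c0 ge_min lexx orbT !andbT arr_ge0 // => j s.
by have /andP[] := IH j s.
Qed.

Let B_loc k i : loc_int (B k i).
Proof.
elim: k i => [|k IH] i /=; first exact: loc_int0.
apply: loc_int_outflow => //; first exact: loc_int_arrival.
by move=> t; apply: arr_ge0 => j s; have /andP[] := B_bounds k j s.
Qed.

(** For [t < 0] both iterates lie between 0 and [c i t = 0]; this starts the induction, and each
    round gains one delay [d]. *)
Let B_step k i t : t < k%:R * d -> B k.+1 i t = B k i t.
Proof.
elim: k i t => [|k IH] i t.
  rewrite mul0r => t0; have := B_bounds 1 i t; rewrite c_neg // -eq_le.
  by move=> /eqP <-.
move=> tk; rewrite [RHS]/B [LHS]/B /= -/departure_iter.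
apply: outflow_causal => s st; rewrite /arrival; congr (_ + _).
apply: eq_bigr => j _; congr (_ * _); apply: IH.
rewrite ltrBlDr; apply: (le_lt_trans st); apply: (lt_le_trans tk).
by rewrite -natr1 mulrDl mul1r lerD2l.
Qed.

Let B_stable k m i t : t < k%:R * d -> B (m + k) i t = B k i t.
Proof.
move=> tk; elim: m => [//|m <-]; rewrite addSn B_step //.
by apply: (lt_le_trans tk); rewrite ler_pM2r // ler_nat leq_addl.
Qed.

Let K t := (Num.trunc (t / d)).+1.

Let ltK t : t < (K t)%:R * d.
Proof. by rewrite -ltr_pdivrMr // truncnS_gt. Qed.

Let bl i t := B (K t) i t.

Let blE k i t : t < k%:R * d -> bl i t = B k i t.
Proof.
move=> tk; rewrite /bl; case: (leqP k (K t)) => h.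
  by rewrite -(subnK h) B_stable.
by rewrite -(subnK (ltnW h)) B_stable.
Qed.

Let bl_loc i : loc_int (bl i).
Proof.
apply: (loc_int_dom _ (lc i)).
  apply: (@measurable_fun_cvg _ _ _ _ (fun k => B k i)).
    by move=> k; exact: loc_int_meas.
  move=> t _; apply: cvg_near_cst; exists (K t) => // k /= hk.
  apply/esym/blE; apply: (lt_le_trans (ltK t)).
  by rewrite ler_pM2r // ler_nat.
apply: aeW => t; have /andP[h1 h2] := B_bounds (K t) i t.
by rewrite !ger0_norm.
Qed.

Lemma net_exists_aux : exists x, net x bl.
Proof.
exists (fun i => workload (fun t => arrival bl i t - c i t)) => i.
have -> : bl i = outflow (arrival bl i) (c i).
  (* One iterate more than necessary, so that it unfolds as the outflow of an iterate that is final
     up to [t]. *)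
  apply/funext => t; rewrite (@blE (K t).+1); last first.
    by apply: (lt_le_trans (ltK t)); rewrite ler_pM2r // ler_nat.
  have -> : B (K t).+1 i t = outflow (arrival (B (K t)) i) (c i) t by [].
  apply: outflow_causal => s st.
  rewrite /arrival; congr (_ + _); apply: eq_bigr => j _; congr (_ * _).
  apply/esym/blE; apply: le_lt_trans (ltK t); rewrite lerBlDr (le_trans st) // lerDl.
  exact: ltW.
apply: queue_empty => //; first exact: loc_int_arrival.
move=> t; apply: arr_ge0 => j s.
by have /andP[] := B_bounds (K s) j s.
Qed.

End Existence.

Lemma net_exists : exists x b, net x b.
Proof.
have [d d0 dtau] := min_travel_time.
by have [x H] := net_exists_aux d0 dtau; exists x; eexists; exact: H.
Qed.

Lemma net_loc x b i : net x b -> loc_int (b i).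
Proof. by move=> /(_ i)[]. Qed.

Lemma net_loc_arrival x b i : net x b -> loc_int (arrival b i).
Proof. by move=> nb; apply: loc_int_arrival => j; exact: net_loc nb. Qed.

Lemma net_shift x b s : 0 <= s ->
  (forall i t, 0 <= t -> e i (t + s) = e i t) ->
  (forall i t, 0 <= t -> c i (t + s) = c i t) ->
  net x b -> net (fun i t => x i (t + s)) (fun i t => b i (t + s)).
Proof.
move=> s0 es cs nb i; have [lb xi0 _ H] := nb i.
have lbs j : loc_int (fun t => b j (t + s)).
  have -> : (fun t => b j (t + s)) = (fun t => b j (t - - s)).
    by apply/funext => t; rewrite opprK.
  by apply: loc_int_shift; exact: net_loc nb.
apply: queue_of_int => //.
- exact: loc_int_arrival.
- by move=> t t0; apply: xi0; exact: addr_ge0.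
- move=> t t0; rewrite add0r; apply/eqP; rewrite -subr_eq0 opprD addrA subr_eq0; apply/eqP.
  rewrite (queue_int (net_loc_arrival i nb) (nb i) s0); last by rewrite lerDr.
  have := @I_shift _ (fun u => arrival b i u - b i u) (- s) 0 t.
  rewrite opprK add0r => <-; last first.
    by apply: loc_intB => //; exact: net_loc_arrival nb.
  apply: eq_I => u u0 ut; rewrite /arrival es //.
  by congr (_ + _ - _); apply: eq_bigr => j _; rewrite addrAC.
- apply: ae_imp (ae_shift (- s) H) => t; rewrite opprK => Ht t0.
  have [|_ h1 h2] := Ht; first by rewrite ltr_wpDr.
  by split; rewrite -(cs i t (ltW t0)).
Qed.

Variable h : R.
Hypothesis tauh : forall i j, tau i j <= h.

(** * L^1 merging of two trajectories *)

Section TwoSolutions.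
Variables (x b x' b' : 'I_n -> R -> R).
Hypotheses (nb : net x b) (nb' : net x' b').
Let D j t := `|b j t - b' j t|.

Let lD j : loc_int (D j).
Proof. by apply: loc_int_norm; apply: loc_intB; [exact: net_loc nb|exact: net_loc nb']. Qed.

(** Delays lie between 0 and [h], so whatever arrives during [s, t] departed during [s - h, t]. *)
Lemma arrival_diff i s t : s <= t ->
  I (fun u => `|arrival b i u - arrival b' i u|) s t <=
  \sum_(j < n) I (D j) (s - h) t * r j i.
Proof.
move=> st.
have lDs j : loc_int (fun u => D j (u - tau j i) * r j i).
  by apply: loc_intZ; exact: loc_int_shift.
apply: (@le_trans _ _ (I (fun u => \sum_(j < n) D j (u - tau j i) * r j i) s t)).
  apply: I_le.
  - by apply: loc_int_norm; apply: loc_intB; [exact: net_loc_arrival nb|exact: net_loc_arrival nb'].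
  - exact: loc_int_sum.
  - apply: aeW => u _ _; rewrite /arrival opprD addrACA subrr add0r -sumrB.
    apply: le_trans (ler_norm_sum _ _ _) _; apply: ler_sum => j _.
    by rewrite -mulrBl normrM (ger0_norm (r0 _ _)).
rewrite I_sum //; apply: ler_sum => j _.
rewrite I_Z; last exact: loc_int_shift.
rewrite ler_wpM2r // I_shift //.
have t0 := ltW (tau0 j i).
apply: I_mono => //; [by rewrite /D => u|by rewrite lerD2l lerN2|by rewrite lerD2r|].
by rewrite gerBl.
Qed.

Variable w : 'I_n -> R.
Hypotheses (w0 : forall i, 0 <= w i) (wr : forall j, \sum_(i < n) w i * r j i = w j - 1).

(* [sum_i w i * |x i - x' i|] plus the weighted difference of the flows in transit
   decreases at rate [sum_j |b j - b' j|]. *)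
Lemma net_l1_bound : exists K : R, forall t, 0 <= t ->
  \sum_(j < n) I (D j) 0 t <= K.
Proof.
exists (\sum_(i < n) w i * (`|x i 0 - x' i 0| + \sum_(j < n) I (D j) (- h) 0 * r j i)).
move=> t t0; pose J j := I (D j) 0 t.
have key i : w i * J i <= w i * (`|x i 0 - x' i 0| +
    \sum_(j < n) I (D j) (- h) 0 * r j i) + \sum_(j < n) J j * (w i * r j i).
  have la := net_loc_arrival i nb; have la' := net_loc_arrival i nb'.
  have := queue_contract la la' (nb i) (nb' i) (lexx 0) t0.
  rewrite (I_B _ _ (loc_int_norm (loc_intB la la')) (lD i)).
  have := arrival_diff i t0; rewrite sub0r.
  have -> : \sum_(j < n) I (D j) (- h) t * r j i =
     \sum_(j < n) I (D j) (- h) 0 * r j i + \sum_(j < n) J j * r j i.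
    rewrite -big_split; apply: eq_bigr => j _ /=; rewrite -mulrDl; congr (_ * _).
    apply: I_split => //; rewrite oppr_le0.
    exact: le_trans (ltW (tau0 j j)) (tauh j j).
  have -> : \sum_(j < n) J j * (w i * r j i) = w i * \sum_(j < n) J j * r j i.
    by rewrite mulr_sumr; apply: eq_bigr => j _; rewrite mulrCA.
  rewrite -mulrDr => h1 h2; apply: ler_wpM2l => //.
  have := normr_ge0 (x i t - x' i t); move: h1 h2; rewrite -/(D i) -/(J i).
  set S1 := \sum_(j < n) _; set S2 := \sum_(j < n) _; set S3 := I _ 0 t.
  lra.
have := @ler_sum _ _ (index_enum 'I_n) xpredT _ _ (fun i _ => key i).
rewrite big_split /= exchange_big /=.
have -> : \sum_(j < n) \sum_(i < n) J j * (w i * r j i) = \sum_(j < n) (w j * J j - J j).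
  by apply: eq_bigr => j _; rewrite -mulr_sumr wr mulrBr mulr1 mulrC.
rewrite sumrB; set A := \sum_(i < n) w i * (_ + _); set W := \sum_(i < n) w i * J i.
by rewrite addrA lerBrDr [A + W]addrC lerD2l.
Qed.

Lemma net_l1_tail eps : 0 < eps -> exists2 t0 : R, 0 <= t0 &
  forall s t, t0 <= s -> s <= t -> \sum_(j < n) I (D j) s t <= eps.
Proof.
move=> eps0; have [K HK] := net_l1_bound.
pose J t := \sum_(j < n) I (D j) 0 t.
pose S := [set J t | t in `[0, +oo[].
have supS : has_sup S.
  split; first by exists (J 0); exists 0 => //=; rewrite in_itv /= lexx.
  by exists K => y [t /=]; rewrite in_itv /= andbT => t0 <-; exact: HK.
have [y [t0 /= + Jy] yS] := sup_adherent eps0 supS.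
rewrite in_itv /= andbT => t00; exists t0 => // s t ts st.
have s0 := le_trans t00 ts.
have J_split u v : 0 <= u -> u <= v -> J v = J u + \sum_(j < n) I (D j) u v.
  by move=> u0 uv; rewrite -big_split; apply: eq_bigr => j _; exact: I_split.
have Jt : J t <= sup S.
  apply: ub_le_sup; first by case: supS.
  by exists t => //=; rewrite in_itv /= andbT (le_trans s0).
have Js : J t0 <= J s.
  by rewrite (J_split t0 s) // lerDl sumr_ge0 // => j _; exact: I_norm_ge0.
move: Jt yS; rewrite -Jy (J_split s t) //.
set Z := \sum_(j < n) _; move: Js; set A := J t0; set B := J s; set C := sup S.
lra.
Qed.

End TwoSolutions.

(** * Periodic rates: recurrent emptying and convergence of queue lengths *)

Variables (T : R) (M : 'M[R]_n).
Hypotheses (T0 : 0 < T) (h0 : 0 <= h).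
Hypotheses (e_per : forall i t, 0 <= t -> e i (t + T) = e i t).
Hypotheses (c_per : forall i t, 0 <= t -> c i (t + T) = c i t).
Hypotheses (M0 : forall i j, 0 <= M i j) (MV : M *m (1%:M - r^T) = 1%:M).

Lemma periodic_iter (f : R -> R) k t : (forall t, 0 <= t -> f (t + T) = f t) ->
  0 <= t -> f (t + k%:R * T) = f t.
Proof.
move=> fT t0; elim: k => [|k IH]; first by rewrite mul0r addr0.
rewrite -natr1 mulrDl mul1r addrA fT // addr_ge0 // mulr_ge0 // ltW //.
Qed.

Lemma I_translate (f : R -> R) s u v : loc_int f ->
  I f (u + s) (v + s) = I (fun t => f (t + s)) u v.
Proof.
move=> lf; by have := @I_shift _ f (- s) u v lf; rewrite !opprK => <-.
Qed.

Lemma I_periodic (f : R -> R) k : loc_int f -> (forall t, 0 <= t -> f (t + T) = f t) ->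
  I f (k%:R * T) (k.+1%:R * T) = I f 0 T.
Proof.
move=> lf fT; have := I_translate (k%:R * T) 0 T lf.
rewrite add0r -natr1 mulrDl mul1r addrC => ->.
by apply: eq_I => t t0 _; exact: periodic_iter.
Qed.

Lemma kT_le (k m : nat) : (k <= m)%N -> k%:R * T <= m%:R * T.
Proof. by move=> km; rewrite ler_pM2r // ler_nat. Qed.

Lemma kT_ge0 (k : nat) : 0 <= k%:R * T.
Proof. by rewrite mulr_ge0 // ltW. Qed.

Lemma I_periods (f : R -> R) k m : loc_int f -> (k <= m)%N ->
  I f (k%:R * T) (m%:R * T) = \sum_(k <= l < m) I f (l%:R * T) (l.+1%:R * T).
Proof.
move=> lf km; rewrite -(subnKC km); elim: (m - k)%N => [|l IH].
  by rewrite addn0 I_pt big_geq.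
rewrite addnS big_nat_recr ?leq_addr //= -IH; apply: I_split => //.
  by apply: kT_le; exact: leq_addr.
exact: kT_le.
Qed.

Hypothesis stab : exists2 eps : R, 0 < eps &
  forall i, \sum_(k < n) M i k * I (e k) 0 T + eps <= I (c i) 0 T.

(** Flow balance bounds [(1 - r^T) v], for the vector [v] of total departures, by initial content
    plus external arrivals; the nonnegative inverse [M] preserves this inequality. *)
Lemma net_departure_bound x b i : net x b -> exists Q : R, forall t, 0 <= t ->
  I (b i) 0 t <= Q + \sum_(k < n) M i k * I (e k) 0 t.
Proof.
(* [net] gives no sign to departures at negative times, hence the absolute value. *)
move=> nb; pose H j := I (fun t => `|b j t|) (- h) 0.
pose q k := x k 0 + \sum_(j < n) H j * r j k.
exists (\sum_(k < n) M i k * q k) => t t0.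
pose v : 'cV[R]_n := \col_j I (b j) 0 t.
have lb j : loc_int (b j) := net_loc j nb.
have key k : ((1%:M - r^T) *m v) k 0 <= q k + I (e k) 0 t.
  rewrite mulmxBl mul1mx !mxE.
  have [_ x0 _ _] := nb k.
  have := queue_int (net_loc_arrival k nb) (nb k) (lexx 0) t0.
  rewrite I_B //; last exact: net_loc_arrival nb.
  have lbs j : loc_int (fun u => b j (u - tau j k) * r j k).
    by apply: loc_intZ; exact: loc_int_shift.
  rewrite /arrival I_D //; last exact: loc_int_sum.
  rewrite I_sum // => E.
  suff : \sum_(j < n) I (fun u => b j (u - tau j k) * r j k) 0 t <=
      \sum_(j < n) H j * r j k + \sum_(j < n) r^T k j * v j 0.
    by have := x0 t t0; move: E; rewrite /q; lra.
  rewrite -big_split; apply: ler_sum => j _ /=; rewrite !mxE.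
  rewrite I_Z; last exact: loc_int_shift.
  rewrite [r j k * _]mulrC -mulrDl ler_wpM2r // I_shift //.
  apply: le_trans (ler_norm _) _; apply: le_trans (I_norm _ _ (lb j)) _.
  have -> : H j + I (b j) 0 t = I (fun t => `|b j t|) (- h) t.
    have hn0 : - h <= 0 by rewrite oppr_le0.
    rewrite (I_split (loc_int_norm (lb j)) hn0 t0).
    congr (_ + _); apply: I_eq_ae => //; first exact: loc_int_norm.
    have [_ _ _ Hb] := nb j.
    apply: ae_imp Hb => u Hu u0 _; have [_ _ /andP[bu _]] := Hu u0.
    by rewrite ger0_norm.
  have tj := ltW (tau0 j k).
  apply: I_mono => //; first exact: loc_int_norm.
  - by rewrite add0r lerN2.
  - by rewrite lerD2r.
  - by rewrite gerBl.
have -> : I (b i) 0 t = (M *m ((1%:M - r^T) *m v)) i 0.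
  by rewrite mulmxA MV mul1mx mxE.
rewrite mxE -big_split; apply: ler_sum => k _ /=.
by rewrite -mulrDr ler_wpM2l.
Qed.

Section ZeroWindow.
Variables (x b : 'I_n -> R -> R) (nb : net x b).
Variable w : 'I_n -> R.
Hypotheses (w0 : forall i, 0 <= w i) (wr : forall j, \sum_(i < n) w i * r j i = w j - 1).

(* A period during which the queue never empties lets out [I (c i) 0 T], and so
   (nearly) does every later one, which is more than can arrive. *)
Lemma net_zero_window : exists K0 : nat, forall k, (K0 <= k)%N -> forall i,
  exists t, [/\ k%:R * T <= t, t <= k.+1%:R * T & x i t = 0].
Proof.
have [eps eps0 Heps] := stab.
have lb j : loc_int (b j) := net_loc j nb.
have nbT := net_shift (ltW T0) e_per c_per nb.
have lbT j : loc_int (fun t => b j (t + T)) := net_loc j nbT.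
(* Half of the stability margin is set aside for the drift of the departures per period, measured by
   the L^1 distance between the trajectory and its shift by [T]. *)
have e20 : 0 < eps / 2 by rewrite divr_gt0.
have [t0 t00 Ht0] := net_l1_tail nb nbT w0 wr e20.
have [K0 K0t0] : exists K0 : nat, t0 <= K0%:R * T.
  exists (Num.trunc (t0 / T)).+1; rewrite -ler_pdivrMr //; apply/ltW; exact: truncnS_gt.
exists K0 => k K0k i; apply: contrapT => noz.
pose C := I (c i) 0 T; pose beta l := I (b i) (l%:R * T) (l.+1%:R * T).
have kS (l : nat) : l%:R * T <= l.+1%:R * T by exact: kT_le.
have betak : beta k = C.
  rewrite /C -(I_periodic k (lc i) (c_per i)).
  apply: I_eq_ae => //; have [_ x0 _ Hb] := nb i.
  apply: ae_imp Hb => u Hu ku uk.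
  have u0 : 0 < u := le_lt_trans (kT_ge0 k) ku.
  have [_ bc _] := Hu u0; apply: bc.
  rewrite lt_neqAle x0 ?(ltW u0) // andbT eq_sym; apply/eqP => xu.
  by apply: noz; exists u; rewrite !ltW.
(* The drifts of successive periods are integrals over adjacent intervals, so all of them together
   form one L^1 tail and do not grow with [m]. *)
have beta_near m : (k <= m)%N -> C - eps / 2 <= beta m.
  move=> km.
  have step l : beta l - beta l.+1 <=
      I (fun t => `|b i t - b i (t + T)|) (l%:R * T) (l.+1%:R * T).
    have -> : beta l.+1 = I (fun t => b i (t + T)) (l%:R * T) (l.+1%:R * T).
      have E q : q.+1%:R * T = q%:R * T + T by rewrite -natr1 mulrDl mul1r.
      by rewrite -I_translate // -!E.
    rewrite /beta -I_B //; apply: le_trans (ler_norm _) _.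
    by apply: I_norm; exact: loc_intB.
  have tele : beta k - beta m <=
      I (fun t => `|b i t - b i (t + T)|) (k%:R * T) (m%:R * T).
    rewrite I_periods //; last by apply: loc_int_norm; exact: loc_intB.
    rewrite -(subnKC km); elim: (m - k)%N => [|l IH].
      by rewrite addn0 subrr big_geq.
    rewrite addnS big_nat_recr ?leq_addr //=; have := step (k + l)%N; move: IH.
    set S := \sum_(k <= _ < _) _; set A := I _ _ _.
    set p := beta k; set p1 := beta (k + l)%N; set p2 := beta (k + l).+1; lra.
  have := Ht0 _ _ (le_trans K0t0 (kT_le K0k)) (kT_le km).
  rewrite (bigD1 i) //=; set S := \sum_(_ < _ | _) _ => tail.
  have S0 : 0 <= S by apply: sumr_ge0 => j _; exact: I_norm_ge0.
  move: tele tail; rewrite betak; set A := I _ _ _; lra.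
have [Q HQ] := net_departure_bound i nb.
have sumE m : \sum_(j < n) M i j * I (e j) 0 (m%:R * T) <= m%:R * (C - eps).
  have -> : \sum_(j < n) M i j * I (e j) 0 (m%:R * T) =
     m%:R * \sum_(j < n) M i j * I (e j) 0 T.
    rewrite mulr_sumr; apply: eq_bigr => j _; rewrite mulrCA; congr (_ * _).
    have -> : 0 = 0%:R * T by rewrite mul0r.
    rewrite (I_periods (le j) (leq0n m)).
    under eq_bigr do rewrite (I_periodic _ (le j) (e_per j)).
    by rewrite sumr_const_nat subn0 mul0r mulr_natl.
  by rewrite ler_wpM2l // lerBrDr; exact: Heps.
have lowm m : (k <= m)%N -> (m%:R - k%:R) * (C - eps / 2) <= I (b i) 0 (m%:R * T).
  move=> km; rewrite (I_split (lb i) (kT_ge0 k) (kT_le km)).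
  have h1 : 0 <= I (b i) 0 (k%:R * T).
    apply: I_ge0 => //; have [_ _ _ Hb] := nb i.
    by apply: ae_imp Hb => u Hu u0 _; have [_ _ /andP[]] := Hu u0.
  apply: le_trans (_ : I (b i) (k%:R * T) (m%:R * T) <= _); last by rewrite lerDr.
  rewrite I_periods // -natrB // mulr_natl -sumr_const_nat.
  by apply: ler_sum_nat => l /andP[kl _]; exact: beta_near.
pose z : R := `|Q + k%:R * (C - eps / 2)|.
(* The bounds below give [(m - k) * (C - eps / 2) <= Q + m * (C - eps)], that is,
   [m * (eps / 2) <= Q + k * (C - eps / 2)], which this [m] violates. *)
pose m := (k + (Num.trunc (z / (eps / 2))).+1)%N.
have km : (k <= m)%N by rewrite leq_addr.
have := lowm m km; have := HQ _ (kT_ge0 m); have := sumE m.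
have : `|Q + k%:R * (C - eps / 2)| < m%:R * (eps / 2).
  rewrite -ltr_pdivrMr //; apply: lt_le_trans (truncnS_gt _) _.
  by rewrite ler_nat leq_addl.
have := ler_norm (Q + k%:R * (C - eps / 2)).
move: (m%:R : R) (k%:R : R) => mr kr; set Z := `|_|; set A := I _ _ _.
set S := \sum_(_ < _) _; lra.
Qed.

End ZeroWindow.

Hypothesis r1 : forall i j, r i j <= 1.
Variable w : 'I_n -> R.
Hypotheses (w0 : forall i, 0 <= w i) (wr : forall j, \sum_(i < n) w i * r j i = w j - 1).

Lemma arrival_diff1 x b x' b' i s t : net x b -> net x' b' -> s <= t ->
  I (fun u => `|arrival b i u - arrival b' i u|) s t <=
  \sum_(j < n) I (fun u => `|b j u - b' j u|) (s - h) t.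
Proof.
move=> nb nb' st; apply: (le_trans (arrival_diff nb nb' i st)).
by apply: ler_sum => j _; rewrite ler_piMr // I_norm_ge0.
Qed.

Lemma natmul_ge t : exists k : nat, t <= k%:R * T.
Proof.
exists (Num.trunc (t / T)).+1; rewrite -ler_pdivrMr //; apply/ltW; exact: truncnS_gt.
Qed.

Lemma net_close_le x b x' b' eps : net x b -> net x' b' -> 0 < eps ->
  exists t0 : R, forall t, t0 <= t -> forall i, x i t - x' i t <= eps.
Proof.
move=> nb nb' eps0.
have [t1 t10 Ht1] := net_l1_tail nb nb' w0 wr eps0.
have [K0 HK0] := net_zero_window nb w0 wr.
have [k1 Hk1] := natmul_ge (t1 + h).
(* One emptying, in period [k], serves all later times: that period begins at least [h] after [t1],
   so the L^1 tail also covers arrivals still in transit. *)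
pose k := maxn K0 k1; exists (k.+1%:R * T) => t kt i.
have [s [ks sk xs]] := HK0 k (leq_maxl _ _) i.
have st := le_trans sk kt.
apply: (le_trans (queue_from_zero (net_loc_arrival i nb) (net_loc_arrival i nb')
  (nb i) (nb' i) (kT_ge0 k) ks st xs)).
apply: (le_trans (arrival_diff1 i nb nb' (le_trans ks st))); apply: Ht1.
  by rewrite lerBrDr (le_trans Hk1) // kT_le // leq_maxr.
by rewrite lerBlDr (le_trans (le_trans ks st)) // lerDl.
Qed.

Lemma net_close x b x' b' eps : net x b -> net x' b' -> 0 < eps ->
  exists t0 : R, forall t, t0 <= t -> (forall i, `|x i t - x' i t| <= eps) /\
    \sum_(j < n) I (fun u => `|b j u - b' j u|) (t - h) t <= eps.
Proof.
move=> nb nb' eps0.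
have [t1 Ht1] := net_close_le nb nb' eps0.
have [t2 Ht2] := net_close_le nb' nb eps0.
have [t3 _ Ht3] := net_l1_tail nb nb' w0 wr eps0.
exists (Num.max (Num.max t1 t2) (t3 + h)) => t; rewrite !ge_max => /andP[/andP[h1 h2] h3].
split=> [i|]; first by rewrite ler_norml Ht1 // andbT lerNl opprB Ht2.
by apply: Ht3; [rewrite lerBrDr|rewrite gerBl].
Qed.

(** * The periodic limit and its uniqueness *)

Section PeriodicLimit.
Variables (x b : 'I_n -> R -> R) (nb : net x b).

Let nbT : net (fun i t => x i (t + T)) (fun i t => b i (t + T)).
Proof. exact: net_shift (ltW T0) e_per c_per nb. Qed.

Let D j t := `|b j t - b j (t + T)|.

Let lD j : loc_int (D j).
Proof. by apply: loc_int_norm; apply: loc_intB; [exact: net_loc nb|exact: net_loc nbT]. Qed.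

Let J t := \sum_(j < n) I (D j) 0 t.

Let J_split s t : 0 <= s -> s <= t -> J t = J s + \sum_(j < n) I (D j) s t.
Proof. by move=> s0 st; rewrite -big_split; apply: eq_bigr => j _; exact: I_split. Qed.

(** At time (q+1)T with q = k + p - 1, a zero of [x i] in period q and one in period q + 1, moved
    back by [T], yield the two one-sided bounds between the trajectory and its shift. The [p]
    periods make room for the longest delay and the period of the zeros. *)
Lemma net_period_step (p : nat) : h + T <= p%:R * T -> exists K1 : nat,
  forall k, (K1 <= k)%N -> forall i,
  `|x i ((k + p).+1%:R * T) - x i ((k + p)%:R * T)| <= J ((k + p)%:R * T) - J (k%:R * T).
Proof.
move=> hp.
have [K0 HK0] := net_zero_window nb w0 wr.
have p0 : (0 < p)%N.
  by rewrite lt0n; apply/eqP => p0; move: hp; rewrite p0 mul0r; move: h0 T0; lra.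
exists K0 => k K0k i.
pose q := (k + p).-1%N.
have qE : q.+1 = (k + p)%N by rewrite /q prednK // addn_gt0 p0 orbT.
have K0q : (K0 <= q)%N by rewrite -ltnS qE; apply: (leq_ltn_trans K0k); rewrite -addn1 leq_add2l.
have ST m : m.+1%:R * T = m%:R * T + T by rewrite -natr1 mulrDl mul1r.
have [s [qs sq xs]] := HK0 q K0q i.
have [s' [qs' sq' xs']] := HK0 q.+1 (leqW K0q) i.
have khq : k%:R * T <= q%:R * T - h.
  have : q.+1%:R * T = k%:R * T + p%:R * T by rewrite qE natrD mulrDl.
  by rewrite ST; move: hp; lra.
have qh : q%:R * T - h <= q.+1%:R * T by rewrite ST; move: h0 T0; lra.
have JE : \sum_(j < n) I (D j) (q%:R * T - h) (q.+1%:R * T) <= J (q.+1%:R * T) - J (k%:R * T).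
  rewrite (J_split (kT_ge0 k) (le_trans khq qh)) addrAC subrr add0r.
  by apply: ler_sum => j _; apply: I_mono => // u; rewrite /D.
have la := net_loc_arrival i nb; have la' := net_loc_arrival i nbT.
have qq : q%:R * T <= q.+1%:R * T by exact: kT_le.
rewrite -qE ST ler_norml; apply/andP; split.
  rewrite lerNl opprB; apply: le_trans JE.
  apply: (le_trans (queue_from_zero la la' (nb i) (nbT i) (kT_ge0 q) qs sq xs)).
  exact: (arrival_diff1 i nb nbT qq).
apply: le_trans JE.
have sT : q%:R * T <= s' - T by move: qs'; rewrite ST; lra.
have sT' : s' - T <= q.+1%:R * T by move: sq'; rewrite ST; lra.
have xs0 : x i (s' - T + T) = 0 by rewrite subrK.
apply: (le_trans (queue_from_zero la' la (nbT i) (nb i) (kT_ge0 q) sT sT' xs0)).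
apply: (le_trans (arrival_diff1 i nbT nb qq)).
by apply: ler_sum => j _; rewrite le_eqVlt; apply/orP; left; apply/eqP; apply: eq_I => u _ _; rewrite distrC.
Qed.

Lemma net_period_cvg i : cvgn (fun k => x i (k%:R * T)).
Proof.
have [p hp] := natmul_ge (h + T).
have [K1 HK1] := net_period_step hp.
have [K HK] := net_l1_bound nb nbT w0 wr.
suff /cvg_ex[l yl] : cvgn (fun k => x i ((k + (K1 + p))%:R * T)).
  by apply/cvg_ex; exists l; rewrite -(cvg_shiftn (K1 + p)).
(* The windows of [net_period_step] overlap [p]-fold. Summing [J] at [p] successive periods gives a
   sequence whose increments telescope to exactly those windows, bounded by [p] times the bound on
   [J]. *)
apply: (@cvg_of_step _ (fun k => \sum_(l < p) J ((k + K1 + l)%:R * T)) (p%:R * K)) => k.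
  have := HK1 (k + K1)%N (leq_addl _ _) i.
  rewrite -addSn -addSn -!addnA => H; apply: (le_trans H).
  have -> : \sum_(l < p) J ((k.+1 + K1 + l)%:R * T) - \sum_(l < p) J ((k + K1 + l)%:R * T) =
      \sum_(0 <= l < p) (J ((k + (K1 + l.+1))%:R * T) - J ((k + (K1 + l))%:R * T)).
    rewrite -sumrB big_mkord; apply: eq_bigr => l _.
    by rewrite !addnA addnS !addSn.
  by rewrite (telescope_sumr (fun l => J ((k + (K1 + l))%:R * T))) // addn0.
rewrite mulr_natl -[p in X in _ <= X]card_ord -sumr_const; apply: ler_sum => l _.
by apply: HK; exact: kT_ge0.
Qed.

Lemma departure_period_cvg j :
  {ae mu, forall t, 0 < t -> cvgn (fun k : nat => b j (t + k%:R * T))}.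
Proof.
have [K HK] := net_l1_bound nb nbT w0 wr.
have DK t : 0 <= t -> I (D j) 0 t <= K.
  move=> t0; apply: le_trans (HK t t0); rewrite (bigD1 j) //= lerDl.
  by apply: sumr_ge0 => i _; exact: I_norm_ge0.
have D0 t : 0 <= D j t by rewrite /D.
apply: ae_imp (ae_partial_sums T0 (lD j) D0 DK) => t Ht t0.
have [B HB] := Ht t0.
apply: (@cvg_of_step _ (fun m => \sum_(0 <= k < m) D j (t + k%:R * T)) B) => // k.
rewrite big_nat_recr //= addrAC subrr add0r /D distrC.
by rewrite -natr1 mulrDl mul1r addrA.
Qed.

Lemma arrival_int (f : 'I_n -> R -> R) i t : (forall j, loc_int (f j)) ->
  I (arrival f i) 0 t = I (e i) 0 t + \sum_(j < n) I (f j) (0 - tau j i) (t - tau j i) * r j i.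
Proof.
move=> lf; have lfs j : loc_int (fun u => f j (u - tau j i)) by exact: loc_int_shift.
rewrite /arrival I_D //; last by apply: loc_int_sum => j; exact: loc_intZ.
rewrite I_sum; last by move=> j; exact: loc_intZ.
by congr (_ + _); apply: eq_bigr => j _; rewrite I_Z // I_shift.
Qed.

Lemma net_limit : exists xs bs, [/\ net xs bs,
  forall i t, 0 <= t -> xs i (t + T) = xs i t,
  {ae mu, forall t, - h < t -> forall i, bs i (t + T) = bs i t} &
  forall i t, 0 <= bs i t].
Proof.
have [p hp] := natmul_ge (h + T).
(* Shifting by at least [p] periods moves all of []-h, +oo[] to positive times, so the history of
   the limit also comes from departures that obey the queue laws. *)
pose S k := (p + k)%:R * T.
have SE k : S k = p%:R * T + k%:R * T by rewrite /S natrD mulrDl.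
have S0 k : 0 <= S k by exact: kT_ge0.
pose B k j u := b j (u + S k); pose X k i t := x i (t + S k).
have netk k : net (X k) (B k).
  apply: (net_shift (S0 k) _ _ nb) => i t t0; first exact: (periodic_iter _ (e_per i)).
  exact: (periodic_iter _ (c_per i)).
have lB k j : loc_int (B k j) := net_loc j (netk k).
have pos u : - h < u -> 0 < u + p%:R * T by move: hp T0; lra.
have bnd : {ae mu, forall u, - h < u -> forall (k : nat) j, 0 <= B k j u <= c j (u + p%:R * T)}.
  have H : forall k : nat, {ae mu, forall u, - h < u -> forall j, 0 <= B k j u <= c j (u + p%:R * T)}.
    move=> k; have Hj j : {ae mu, forall u, - h < u -> 0 <= B k j u <= c j (u + p%:R * T)}.
      have [_ _ _ Hb] := nb j.
      apply: ae_imp (ae_shift (- S k) Hb) => u; rewrite opprK => Hu hu.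
      have uS : 0 < u + S k by rewrite SE addrA ltr_pwDl ?pos // kT_ge0.
      have Ec : c j (u + S k) = c j (u + p%:R * T).
        by rewrite SE addrA; exact: (periodic_iter _ (c_per j) (ltW (pos u hu))).
      by have [_ _] := Hu uS; rewrite Ec.
    by apply: ae_imp (ae_forall_ord Hj) => u Hu hu j; exact: Hu.
  by apply: ae_imp (ae_foralln H) => u Hu hu k; exact: Hu.
(* Clamping to [0, c] only changes null sets, and gives a limit that is locally
   integrable and nonnegative everywhere. *)
pose B' (j : 'I_n) k u := Num.min (c j (u + p%:R * T)) (Num.max 0 (B k j u)).
have lcp j : loc_int (fun u => c j (u + p%:R * T)).
  by have := loc_int_shift (- (p%:R * T)) (lc j); under eq_fun do rewrite opprK.
have B'bnd j k u : 0 <= B' j k u <= c j (u + p%:R * T).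
  by rewrite /B' le_min c0 le_max lexx ge_min lexx.
(* [limn_sup] is measurable whether or not the sequence converges, and is the limit wherever there
   is one. *)
pose bs j u := Num.min (c j (u + p%:R * T)) (Num.max 0 (limn_sup (fun k => B' j k u))).
have bs0 j u : 0 <= bs j u by rewrite /bs le_min c0 le_max lexx.
have lbs j : loc_int (bs j).
  apply: (loc_int_dom _ (lcp j)).
    apply: measurable_minr; first exact: loc_int_meas.
    apply: measurable_maxr => //; apply: measurable_fun_limn_sup.
    - by move=> u _; exists (c j (u + p%:R * T)) => _ [k _ <-]; have /andP[] := B'bnd j k u.
    - by move=> u _; exists 0 => _ [k _ <-]; have /andP[] := B'bnd j k u.
    - move=> k; apply: measurable_minr; first exact: loc_int_meas.
      by apply: measurable_maxr => //; exact: loc_int_meas.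
  by apply: aeW => u; rewrite !ger0_norm // /bs ge_min lexx.
have Blim : {ae mu, forall u, - h < u -> forall j, (fun k => B k j u) @ \oo --> bs j u}.
  have H j := ae_shift (- (p%:R * T)) (departure_period_cvg j).
  apply: ae_imp (ae_and bnd (ae_forall_ord H)) => u [H1 H2] hu j.
  have := H2 j; rewrite opprK => /(_ (pos u hu)) /cvg_ex[l].
  under eq_fun do rewrite -addrA -SE.
  move=> Bl; have B'E : (fun k => B' j k u) = (fun k => B k j u).
    apply/funext => k; have /andP[B0 Bc] := H1 hu k j.
    by rewrite /B' (max_idPr B0) (min_idPr Bc).
  have l0 : 0 <= l.
    by apply: (cvgr_to_ge Bl); apply: nearW => k; have /andP[] := H1 hu k j.
  have lc' : l <= c j (u + p%:R * T).
    by apply: (cvgr_to_le Bl); apply: nearW => k; have /andP[] := H1 hu k j.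
  by rewrite /bs B'E (cvg_limn_inf_sup Bl).2 (max_idPr l0) (min_idPr lc').
have IB j u v : - h <= u -> (fun k => I (B k j) u v) @ \oo --> I (bs j) u v.
  move=> hu; apply: (@I_cvg _ _ _ (fun t => c j (t + p%:R * T))) => //.
    by apply: ae_imp Blim => t Ht ut _; apply: Ht; exact: le_lt_trans ut.
  apply: ae_imp bnd => t Ht ut _ k.
  by have /andP[B0 Bc] := Ht (le_lt_trans hu ut) k j; rewrite ger0_norm.
(* Defined by the balance equation, which is what [queue_of_int] asks for; [Xlim] identifies it with
   the limit of the shifted queue lengths. *)
pose xs i t := limn (fun k => x i (k%:R * T)) + I (fun u => arrival bs i u - bs i u) 0 t.
have lar i : loc_int (arrival bs i) by exact: loc_int_arrival.
have Xlim i t : 0 <= t -> (fun k => X k i t) @ \oo --> xs i t.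
  move=> t0.
  have -> : (fun k => X k i t) = (fun k => X k i 0 + (I (e i) 0 t +
      \sum_(j < n) I (B k j) (0 - tau j i) (t - tau j i) * r j i - I (B k i) 0 t)).
    apply/funext => k; have := queue_int (net_loc_arrival i (netk k)) (netk k i) (lexx 0) t0.
    rewrite I_B //; last exact: net_loc_arrival (netk k).
    by rewrite arrival_int // => <-; rewrite addrC subrK.
  rewrite /xs I_B // arrival_int //; apply: cvgD.
    have /cvg_ex[l xl] := @net_period_cvg i.
    rewrite (cvg_lim _ xl) //.
    have -> : (fun k => X k i 0) = (fun k => x i ((k + p)%:R * T)).
      by apply/funext => k; rewrite /X add0r /S addnC.
    by rewrite (cvg_shiftn p (fun k => x i (k%:R * T))).
  apply: cvgB; last by apply: IB; rewrite oppr_le0.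
  apply: cvgD; first exact: cvg_cst.
  apply: cvg_big => [|j _]; first exact: add_continuous.
  apply: cvgM; last exact: cvg_cst.
  by apply: IB; rewrite add0r lerN2.
exists xs, bs; split => //.
- move=> i; apply: queue_of_int => //.
  + move=> t t0; apply: (cvgr_to_ge (Xlim i t t0)); apply: nearW => k.
    by have [_ x0 _ _] := netk k i; exact: x0.
  + by move=> t t0; rewrite /xs I_pt addr0.
  + have Hk : forall k : nat, {ae mu, forall t, 0 < t ->
        (0 < X k i t -> B k i t = c i t) /\ 0 <= B k i t <= c i t}.
      by move=> k; have [_ _ _ H] := netk k i; apply: ae_imp H => t Ht t0; have [] := Ht t0.
    apply: ae_imp (ae_and (ae_foralln Hk) Blim) => t [H1 H2] t0.
    have ht : - h < t by apply: le_lt_trans t0; rewrite oppr_le0.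
    have Bl := H2 ht i; have Xl := Xlim i t (ltW t0); split.
      (* A positive limit makes the shifted queues eventually busy, so their departure rates are
         eventually equal to [c i t]. *)
      move=> xs0; have : \forall k \near \oo, 0 < X k i t by exact: cvgr_gt Xl _ xs0.
      move=> Xpos; apply/esym; apply: (cvg_unique _ _ Bl) => //.
      apply: cvg_near_cst; apply: filterS Xpos => k Xk.
      by have [-> //] := H1 k t0.
    apply/andP; split.
      by apply: (cvgr_to_ge Bl); apply: nearW => k; have [_ /andP[]] := H1 k t0.
    by apply: (cvgr_to_le Bl); apply: nearW => k; have [_ /andP[]] := H1 k t0.
- move=> i t t0.
  have tT : 0 <= t + T by rewrite addr_ge0 // ltW.
  (* Adding [T] replaces the k-th shift by the next one, and a sequence and its tail have the same
     limit. *)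
  have L1 := Xlim i _ tT.
  have L2 := Xlim i t t0; rewrite -(cvg_shiftS (fun k => X k i t)) in L2.
  have E : (fun k => X k i (t + T)) = (fun k => X k.+1 i t).
    by apply/funext => k; rewrite /X /S addnS -natr1 mulrDl mul1r addrA addrAC.
  by rewrite E in L1; exact: (cvg_unique _ L1 L2).
- apply: ae_imp (ae_and Blim (ae_shift (- T) Blim)) => u; rewrite opprK => -[H1 H2] hu i.
  have L1 : (fun k => B k i (u + T)) @ \oo --> bs i (u + T).
    by apply: H2; rewrite (lt_trans hu) // ltrDl.
  have L2 := H1 hu i; rewrite -(cvg_shiftS (fun k => B k i u)) in L2.
  have E : (fun k => B k i (u + T)) = (fun k => B k.+1 i u).
    by apply/funext => k; rewrite /B /S addnS -natr1 mulrDl mul1r addrA addrAC.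
  by rewrite E in L1; exact: (cvg_unique _ L1 L2).
Qed.

(** A periodic difference that tends to 0 vanishes. For departures, the L^1 difference over [-h, m]
    is unchanged by translation through [k] periods, and the translates lie arbitrarily far in the
    L^1 tail. *)
Lemma net_unique x' b' : net x' b' ->
  (forall i t, 0 <= t -> x i (t + T) = x i t) -> (forall i t, 0 <= t -> x' i (t + T) = x' i t) ->
  {ae mu, forall t, - h < t -> forall i, b i (t + T) = b i t} ->
  {ae mu, forall t, - h < t -> forall i, b' i (t + T) = b' i t} ->
  (forall i t, 0 <= t -> x i t = x' i t) /\
  {ae mu, forall t, - h < t -> forall i, b i t = b' i t}.
Proof.
move=> nb' xT x'T bT b'T; split.
  move=> i t t0; apply/eqP; rewrite -subr_eq0 -normr_le0; apply/ler_addgt0Pr => eps eps0.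
  rewrite add0r; have [t1 Ht1] := net_close nb nb' eps0.
  have [k Hk] := natmul_ge (t1 - t).
  have tk : t1 <= t + k%:R * T by rewrite addrC -lerBlDr.
  have [/(_ i) + _] := Ht1 _ tk.
  by rewrite (periodic_iter _ (xT i)) // (periodic_iter _ (x'T i)).
pose g j t := `|b j t - b' j t|.
have lg j : loc_int (g j).
  by apply: loc_int_norm; apply: loc_intB; [exact: net_loc nb|exact: net_loc nb'].
have bk (f : 'I_n -> R -> R) k : {ae mu, forall t, - h < t -> forall i, f i (t + T) = f i t} ->
    {ae mu, forall t, - h < t -> forall i, f i (t + k%:R * T) = f i t}.
  move=> fT; elim: k => [|k IH]; first by apply: aeW => t _ i; rewrite mul0r addr0.
  apply: ae_imp (ae_and IH (ae_shift (- (k%:R * T)) fT)) => t [H1 H2] ht i.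
  rewrite -H1 // -natr1 mulrDl mul1r addrA; move: H2; rewrite opprK; apply.
  by rewrite (lt_le_trans ht) // lerDl kT_ge0.
have g0 j m : I (g j) (- h) m = 0.
  have [mh|hm] := ltP m (- h).
    by rewrite /I set_itv_ge ?Rintegral_set0 // bnd_simp -ltNge.
  apply/eqP; rewrite eq_le I_norm_ge0 andbT; apply/ler_addgt0Pr => eps eps0.
  rewrite add0r; have [t1 _ Ht1] := net_l1_tail nb nb' w0 wr eps0.
  have [k Hk] := natmul_ge (t1 + h).
  have -> : I (g j) (- h) m = I (g j) (- h + k%:R * T) (m + k%:R * T).
    rewrite I_translate //; apply: I_eq_ae => //.
      by have := loc_int_shift (- (k%:R * T)) (lg j); under eq_fun do rewrite opprK.
    apply: ae_imp (ae_and (bk _ k bT) (bk _ k b'T)) => t [H1 H2] ht _.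
    by rewrite /g H1 // H2.
  apply: le_trans (Ht1 (- h + k%:R * T) (m + k%:R * T) _ _).
  - by rewrite (bigD1 j) //= lerDl; apply: sumr_ge0 => i _; exact: I_norm_ge0.
  - by rewrite addrC lerBrDr.
  - by rewrite lerD2r.
have ae0 j (m : nat) : {ae mu, forall t, - h < t -> t < m%:R -> b j t = b' j t}.
  pose E : set (measurableTypeR R) := `[- h, m%:R]%classic.
  have mE : measurable E by exact: measurable_itv.
  have mg : measurable_fun E (EFin \o g j) by exact: loc_int_emeas.
  have /(ae_eq_integral_abs mu mE mg) : (\int[mu]_(t in E) `|(EFin \o g j) t| = 0)%E.
    under eq_integral do rewrite /= normr_id.
    by rewrite -[RHS](congr1 EFin (g0 j m%:R)) /I /Rintegral fineK // integrable_fin_num //; exact: lg.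
  apply: ae_imp => t Ht ht tm; apply/eqP; rewrite -subr_eq0 -normr_eq0; apply/eqP.
  have /Ht : E t by rewrite /E /= in_itv /= !ltW.
  by move=> [].
have ae1 j : {ae mu, forall t, - h < t -> b j t = b' j t}.
  apply: ae_imp (ae_foralln (ae0 j)) => t Ht ht.
  apply: (Ht (Num.trunc t).+1) => //; exact: truncnS_gt.
by apply: ae_imp (ae_forall_ord ae1) => t Ht ht i; exact: Ht.
Qed.

End PeriodicLimit.
End Network.

(** * The theorem *)

Section Statement.
Context {R : realType} {n : nat}.
Local Notation mu := (@lebesgue_measure R).
Implicit Types (f : R -> R) (x b : 'I_n -> R -> R) (t : R).

Lemma exprmx_ge0 (A : 'M[R]_n) k : (forall i j, 0 <= A i j) ->
  forall i j, 0 <= (A ^+ k) i j.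
Proof.
move=> A0; elim: k => [|k IH] i j; first by rewrite expr0 mxE; case: eqP.
by rewrite exprS mxE; apply: sumr_ge0 => l _; exact: mulr_ge0.
Qed.

(** The inverse is a limit of partial sums of entrywise nonnegative powers. *)
Lemma neumann_ge0 (A : 'M[R]_n) : (forall i j, 0 <= A i j) -> neumann_invertible A ->
  forall i j, 0 <= invmx (1%:M - A) i j.
Proof.
move=> A0 [_ lim] i j.
have cij : (fun N : nat => (\sum_(k < N) A ^+ k) i j) @ \oo --> invmx (1%:M - A) i j.
  exact: (cvg_comp _ _ lim (@coord_continuous _ _ _ i j (invmx (1%:M - A)))).
apply: (cvgr_to_ge cij); apply: nearW => N; rewrite summxE; apply: sumr_ge0 => k _.
exact: exprmx_ge0.
Qed.

(** Sum column [j] of the identity [M *m (1%:M - r^T) = 1%:M] over its rows. *)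
Lemma column_sums (r : 'M[R]_n) (M : 'M[R]_n) : M *m (1%:M - r^T) = 1%:M ->
  forall j, \sum_(i < n) (\sum_(k < n) M k i) * r j i = \sum_(k < n) M k j - 1.
Proof.
move=> H j.
have E k : \sum_(i < n) M k i * r j i = M k j - (k == j)%:R.
  have := congr1 (fun B : 'M[R]_n => B k j) H.
  rewrite mulmxBr mulmx1 !mxE => <-; rewrite opprB addrC subrK.
  by apply: eq_bigr => i _; rewrite mxE.
under eq_bigr do rewrite mulr_suml.
rewrite exchange_big /=; under eq_bigr do rewrite E.
rewrite sumrB; congr (_ - _); rewrite (bigD1 j) //= eqxx big1 ?addr0 // => k.
by move=> /negPf ->.
Qed.

Lemma norm_col_le (v : 'I_n -> R) (eps : R) : 0 <= eps -> (forall i, `|v i| <= eps) ->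
  `|\col_i v i : 'cV[R]_n| <= eps.
Proof.
move=> e0 H; rewrite [leLHS]mx_normrE; apply/bigmax_leP; split => // -[i j] _ /=.
by rewrite mxE.
Qed.

(** Trajectories and rates carry meaning only on half-lines; the zero extension meets [loc_int] on
    the whole line and makes service vanish before time 0. *)
Definition from (a : R) f t : R := if a <= t then f t else 0.

Lemma fromE a f t : a <= t -> from a f t = f t.
Proof. by rewrite /from => ->. Qed.

Lemma from_ge0 a f t : (forall t, a <= t -> 0 <= f t) -> 0 <= from a f t.
Proof. by move=> f0; rewrite /from; case: ifP => // /f0. Qed.

Lemma loc_int_from a f : (forall m, a <= m -> mu.-integrable `[a, m] (EFin \o f)) ->
  loc_int (from a f).
Proof.
move=> fi u v; pose m := Num.max a v.
have am : a <= m by rewrite le_max lexx.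
have := fi m am; rewrite integrable_mkcond //= => H.
have {}H : mu.-integrable `[u, v] ((EFin \o f) \_ `[a, m]) by exact: integrableS H.
apply: eq_integrable H => // t; rewrite inE /= in_itv /= => /andP[ut tv].
rewrite patchE /from.
have -> : (t \in `[a, m]%classic) = (a <= t).
  by rewrite mem_setE in_itv /= le_max tv orbT andbT.
by case: ifP.
Qed.

Lemma loc_int_rate f : rate_function f -> loc_int (from 0 f).
Proof. by move=> [_ H]; exact: loc_int_from. Qed.

Variables (r : 'M[R]_n) (tau : 'I_n -> 'I_n -> R) (e c : 'I_n -> R -> R).
Hypotheses (c_rate : forall i, rate_function (c i)).
Let h := max_travel_time tau.
Let e' i := from 0 (e i).
Let c' i := from 0 (c i).
Let past b i := from (- h) (b i).

Lemma le_max_travel_time i j : tau i j <= max_travel_time tau.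
Proof.
apply: le_trans (le_bigmax _ _ i).
exact: (le_bigmax _ (fun j => tau i j) j).
Qed.

Lemma max_travel_time_ge0 : 0 <= max_travel_time tau.
Proof. exact: bigmax_ge_id. Qed.

Let hn0 : - h <= 0. Proof. by rewrite oppr_le0; exact: max_travel_time_ge0. Qed.

(** The point to check is integrability of departures: up to time 0 it is part of the initial
    condition, and afterwards they are dominated by the service rate. The two pieces are glued along
    [-h, 0[ and [0, m]. *)
Lemma net_of_trajectory x b : trajectory r tau e c x b -> net r tau e' c' x (past b).
Proof.
move=> [adm mb x0 aF H] i.
have H0 := ae_and (ae_neq 0) H.
have lb j : loc_int (past b j).
  have [_ bpos bint] := adm j.
  apply: loc_int_from => m hm.
  pose D1 : set (measurableTypeR R) := `[- h, 0[%classic.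
  pose D2 : set (measurableTypeR R) := `[0, m]%classic.
  have int2 : mu.-integrable D2 (EFin \o b j).
    have mb2 : measurable_fun D2 (EFin \o b j).
      apply/measurable_EFinP.
      have h1 : measurable_fun (D2 : set R) (b j).
        by apply: measurable_funS (mb j) => // t; rewrite /D2 /= !in_itv /= andbT => /andP[].
      exact: h1.
    apply/integrableP; split => //.
    have := loc_int_rate (c_rate j) 0 m => /integrableP[mc]; apply: le_lt_trans.
    apply: ae_ge0_le_integral => //=.
    - exact: measurable_itv.
    - by apply/measurable_EFinP/measurableT_comp => //; exact/measurable_EFinP.
    - by apply/measurable_EFinP/measurableT_comp => //; exact/measurable_EFinP.
    - apply: ae_imp H0 => t [/eqP tn0 Ht]; rewrite /D2 /= in_itv /= => /andP[t0 _].
      have [_ bc bc0] := Ht t0 j.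
      rewrite (fromE _ t0) lee_fin.
      have bb : 0 <= b j t <= c j t.
        have := x0 j t t0; rewrite le_eqVlt => /orP[/eqP/esym /bc0 //|/bc ->].
        by have [c0 _] := c_rate j; rewrite c0 // lexx.
      by case/andP: bb => b0 bcj; rewrite !ger0_norm // (le_trans b0).
  have mD1 : measurable D1 by exact: measurable_itv.
  have int1 : mu.-integrable D1 (EFin \o b j).
    apply: integrableS bint => // t; rewrite /D1 /= !in_itv /= => /andP[-> /ltW].
    exact.
  have mD2 : measurable D2 by exact: measurable_itv.
  have patchT D : measurable D -> mu.-integrable D (EFin \o b j) ->
      mu.-integrable `[- h, m] ((EFin \o b j) \_ D).
    by move=> mD; rewrite integrable_mkcond // => H1; exact: integrableS H1.
  apply: eq_integrable (integrableD _ (patchT _ mD1 int1) (patchT _ mD2 int2)) => // t.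
  rewrite inE /= in_itv /= => /andP[ht tm]; rewrite !patchE.
  have -> : (t \in D1) = (t < 0) by rewrite mem_setE in_itv /= ht.
  have -> : (t \in D2) = (0 <= t) by rewrite mem_setE in_itv /= tm andbT.
  by case: (leP 0 t) => _; rewrite ?add0e ?adde0.
split => //; [exact: x0|exact: aF|].
apply: ae_imp H0 => t [/eqP tn0 Ht] t0; have [dx bc bc0] := Ht (ltW t0) i.
have ht : - h <= t by apply: le_trans (ltW t0).
have arrE : arrival r tau e' (past b) i t = e i t + \sum_(j < n) b j (t - tau j i) * r j i.
  rewrite /arrival /e' (fromE _ (ltW t0)); congr (_ + _); apply: eq_bigr => j _.
  rewrite /past fromE // lerBrDr addrC -lerBrDr opprK.
  by apply: le_trans (le_max_travel_time j i) _; rewrite lerDr ltW.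
rewrite arrE /past /c' (fromE _ ht) (fromE _ (ltW t0)); split => //.
have := x0 i t (ltW t0); rewrite le_eqVlt => /orP[/eqP/esym /bc0 //|/bc ->].
by have [c0 _] := c_rate i; rewrite c0 ?lexx // ltW.
Qed.

(** Admissibility asks for a nonnegative history at every point, which [net] does not give; the
    clamping in [net_limit] supplies it. *)
Lemma trajectory_of_net x b : net r tau e' c' x b -> (forall i t, 0 <= b i t) ->
  trajectory r tau e c x b.
Proof.
move=> nb b0; split.
- move=> i; have [lb x0 _ _] := nb i; split => //; exact: x0.
- move=> i; have [lb _ _ _] := nb i; have := loc_int_meas lb.
  by move=> H; exact: measurable_funS H.
- by move=> i; have [] := nb i.
- by move=> i; have [] := nb i.
have H i : {ae mu, forall t, 0 < t -> [/\ is_derive t 1 (x i)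
      (e i t + \sum_(j < n) b j (t - tau j i) * r j i - b i t),
      0 < x i t -> b i t = c i t & x i t = 0 -> 0 <= b i t <= c i t]}.
  have [_ _ _ Hb] := nb i; apply: ae_imp Hb => t Ht t0; have := Ht t0.
  rewrite /arrival /e' /c' !(fromE _ (ltW t0)) => -[h1 h2 h3]; split => // _.
apply: ae_imp (ae_and (ae_neq 0) (ae_forall_ord H)) => t [/eqP tn0 Ht] t0 i.
by apply: Ht; rewrite lt_neqAle eq_sym tn0.
Qed.

(** Each partial integral over the window is at most the L^1 distance over the whole window. Trapped
    between 0 and [eps], the supremum is finite, and convergence reduces to the reals. *)
Lemma converges_of_close x b xs bs :
  (forall eps : R, 0 < eps -> exists t0 : R, forall t, t0 <= t ->
     (forall i, `|x i t - xs i t| <= eps) /\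
     \sum_(j < n) I (fun u => `|past b j u - bs j u|) (t - h) t <= eps) ->
  (forall i, loc_int (past b i)) -> (forall i, loc_int (bs i)) ->
  converges_to tau x b xs bs.
Proof.
move=> close lb lbs; split.
  apply/cvgrPdist_le => eps e0; have [t0 Ht0] := close _ e0.
  near=> t; rewrite sub0r normrN normr_id; apply: norm_col_le; first exact: ltW.
  by have [] := Ht0 t _; first by near: t; apply: nbhs_pinfty_ge; exact: num_real.
have dist eps : 0 < eps -> \forall t \near +oo,
    (0 <= history_distance tau b bs t <= eps%:E)%E.
  move=> e0; have [t0 Ht0] := close _ e0.
  near=> t.
  have tt0 : t0 <= t by near: t; apply: nbhs_pinfty_ge; exact: num_real.
  have t_ge0 : 0 <= t by near: t; apply: nbhs_pinfty_ge; exact: num_real.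
  have [_ Hs] := Ht0 t tt0.
  have htt : t - h <= t by rewrite gerBl; exact: max_travel_time_ge0.
  apply/andP; split.
    (* The member [s = t] keeps the supremum from being that of the empty set, which is [-oo]. *)
    apply: le_trans (ereal_sup_ubound _); last first.
      by exists t => //=; rewrite in_itv /= lexx andbT.
    by rewrite lee_fin.
  apply: ge_ereal_sup => y [s /=]; rewrite in_itv /= => /andP[hs st] <-.
  rewrite lee_fin; apply: norm_col_le; first exact: ltW.
  move=> i.
  have -> : \int[mu]_(u in `[t - h, s]) (b i u - bs i u) =
      I (fun u => past b i u - bs i u) (t - h) s.
    apply: eq_I => u hu _; rewrite /past fromE //.
    by apply: le_trans hu; rewrite addrC lerDl.
  have ld : loc_int (fun u => past b i u - bs i u) by exact: loc_intB.
  apply: (le_trans (I_norm _ _ ld)); apply: le_trans Hs.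
  rewrite (bigD1 i) //=.
  apply: le_trans (_ : _ <= I (fun u => `|past b i u - bs i u|) (t - h) t) _.
    by apply: I_mono => //; exact: loc_int_norm.
  by rewrite lerDl; apply: sumr_ge0 => j _; exact: I_norm_ge0.
apply/fine_cvgP; split.
  apply: filterS (dist 1 ltr01) => t /andP[h1 h2].
  by rewrite fin_numElt (lt_le_trans _ h1) ?ltNyr // (le_lt_trans h2) ?ltry.
apply/cvgrPdist_le => eps e0; apply: filterS (dist _ e0) => t /andP[h1 h2].
have fin : history_distance tau b bs t \is a fin_num.
  by rewrite fin_numElt (lt_le_trans _ h1) ?ltNyr // (le_lt_trans h2) ?ltry.
by rewrite sub0r normrN /= ger0_norm ?fine_ge0 // -lee_fin fineK.
Unshelve. all: by end_near. Qed.

End Statement.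

Theorem theorem4 (R : realType) (n : nat) (r : 'M[R]_n)
    (tau : 'I_n -> 'I_n -> R) (e c : 'I_n -> R -> R) (T : R)
    (n_gt0 : (0 < n)%N)
    (r_ge0 : forall i j, 0 <= r i j)
    (r_le1 : forall i, \sum_(j < n) r i j <= 1)
    (r_inv : neumann_invertible r^T)
    (tau_gt0 : forall i j, 0 < tau i j)
    (e_rate : forall i, rate_function (e i))
    (c_rate : forall i, rate_function (c i))
    (T_gt0 : 0 < T)
    (e_periodic : forall i, periodic_from 0 T (e i))
    (c_periodic : forall i, periodic_from 0 T (c i))
    (stable : exists2 eps : R, 0 < eps &
       forall i, (invmx (1%:M - r^T) *m average T e + const_mx eps) i ord0
                 < average T c i ord0) :
  exists xs bs : 'I_n -> R -> R,
    [/\ trajectory r tau e c xs bs,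
        periodic_trajectory tau T xs bs,
        forall x b : 'I_n -> R -> R,
          trajectory r tau e c x b -> periodic_trajectory tau T x b ->
          same_trajectory tau x b xs bs &
        forall x b : 'I_n -> R -> R,
          trajectory r tau e c x b -> converges_to tau x b xs bs].
Proof.
pose M := invmx (1%:M - r^T); pose h := max_travel_time tau.
pose e' i := from 0 (e i); pose c' i := from 0 (c i).
have M0 : forall i j, 0 <= M i j by apply: neumann_ge0 => // i j; rewrite mxE.
have MV : M *m (1%:M - r^T) = 1%:M by apply: mulVmx; case: r_inv.
pose w i := \sum_(k < n) M k i.
have w0 i : 0 <= w i by apply: sumr_ge0.
have wr : forall j, \sum_(i < n) w i * r j i = w j - 1 by exact: column_sums.
have le' i : loc_int (e' i) := loc_int_rate (e_rate i).
have lc' i : loc_int (c' i) := loc_int_rate (c_rate i).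
have e0 i t : 0 <= e' i t by apply: from_ge0; case: (e_rate i).
have c0 i t : 0 <= c' i t by apply: from_ge0; case: (c_rate i).
have c_neg i t : t < 0 -> c' i t = 0 by rewrite /c' /from ltNge => /negPf ->.
have per (f : R -> R) : periodic_from 0 T f -> forall t, 0 <= t -> from 0 f (t + T) = from 0 f t.
  by move=> fT t t0; rewrite !fromE ?fT // addr_ge0 // ltW.
have e_per i : forall t, 0 <= t -> e' i (t + T) = e' i t by exact: per.
have c_per i : forall t, 0 <= t -> c' i (t + T) = c' i t by exact: per.
have r1 i j : r i j <= 1.
  by apply: le_trans (r_le1 i); rewrite (bigD1 j) //= lerDl; apply: sumr_ge0.
have tauh : forall i j, tau i j <= h by exact: le_max_travel_time.
have h0 : 0 <= h := max_travel_time_ge0 tau.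
have avg (f : 'I_n -> R -> R) i : I (from 0 (f i)) 0 T = T * average T f i ord0.
  rewrite mxE mulrA mulfV ?mul1r ?gt_eqF //.
  by apply: eq_I => t t0 _; rewrite fromE.
have stab : exists2 eps : R, 0 < eps &
    forall i, \sum_(k < n) M i k * I (e' k) 0 T + eps <= I (c' i) 0 T.
  have [eps eps0 H] := stable; exists (T * eps); first exact: mulr_gt0.
  move=> i; rewrite avg; under eq_bigr do rewrite avg mulrCA.
  rewrite -mulr_sumr -mulrDr ler_pM2l //; apply/ltW; apply: le_lt_trans (H i).
  by rewrite !mxE lerD2r; apply: ler_sum => k _; rewrite !mxE.
(* The shifts of any one trajectory produce the periodic one; all others are then compared with that
   limit. *)
have [x1 [b1 n1]] := net_exists r_ge0 tau_gt0 le' lc' e0 c0 c_neg.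
have [xs [bs [ns xsT bsT bs0]]] := net_limit r_ge0 tau_gt0 le' lc' c0 tauh T_gt0 h0
  e_per c_per M0 MV stab r1 w0 wr n1.
have hT t : - h < t -> - h <= t + T by move=> ht; rewrite (le_trans (ltW ht)) // lerDl ltW.
have ae_h (P : R -> Prop) : {ae (@lebesgue_measure R), forall t, - h < t -> P t} ->
    {ae (@lebesgue_measure R), forall t, - h <= t -> P t}.
  move=> H; apply: ae_imp (ae_and (ae_neq (- h)) H) => t [/eqP th Ht] ht.
  by apply: Ht; rewrite lt_neqAle eq_sym th.
exists xs, bs; split.
- exact: trajectory_of_net.
- by split => //; exact: ae_h.
- move=> x b tr [xT bT].
  have nb := net_of_trajectory c_rate tr.
  have bT' : {ae (@lebesgue_measure R), forall t, - h < t -> forall i,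
      from (- h) (b i) (t + T) = from (- h) (b i) t}.
    apply: ae_imp bT => t Ht ht i; rewrite !fromE ?hT ?(ltW ht) //.
    by apply: Ht; exact: ltW.
  have [xE bE] := net_unique r_ge0 tau_gt0 le' lc' tauh T_gt0 h0
    e_per c_per M0 MV stab r1 w0 wr nb ns xT xsT bT' bsT.
  split => //; apply: ae_h; apply: ae_imp bE => t Ht ht i.
  by rewrite -Ht // fromE // ltW.
- move=> x b tr.
  have nb := net_of_trajectory c_rate tr.
  apply: converges_of_close => [eps eps0|i|i].
  + exact: (net_close r_ge0 tau_gt0 le' lc' tauh T_gt0 h0
      e_per c_per M0 MV stab r1 w0 wr nb ns eps0).
  + exact: (net_loc i nb).
  + exact: (net_loc i ns).
Qed.
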